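(* For every even integer $N\ge 4$ there exist a closed $N$-dimensional Riemannian manifold $(M,g)$ and a one-dimensional totally geodesic foliation $\mathcal F$ of $M$ such that $K_{\mathrm{mix}}>0$, the leaves of $\mathcal F$ are closed geodesics and form a smooth circle fibration (they are the fibers of a smooth fibration of $M$ with fiber $S^1$), the metric $g$ is not bundle-like with respect to this fibration, and moreover $$\nabla_T^\perp R_T=0,\qquad \operatorname{spec}(R_T)=\{\kappa,4\kappa\}$$ at every point, for a constant $\kappa>0$, where the eigenvalue $4\kappa$ is simple and $\kappa$ has multiplicity $N-2$.
   Context: Closed means compact without boundary. For a foliation $\mathcal F$ of a Riemannian manifold $(M,g)$, a mixed plane is a 2-plane spanned by a vector tangent to $\mathcal F$ and a vector orthogonal to $\mathcal F$; $K_{\mathrm{mix}}$ denotes the sectional curvature of mixed planes, and $K_{\mathrm{mix}}>0$ means that it is positive on all mixed planes. A foliation is totally geodesic if its leaves are totally geodesic submanifolds. The metric $g$ is bundle-like with respect to a foliation (or a fibration, whose fibers are the leaves) if locally the foliation is given by the fibers of a Riemannian submersion; for a one-dimensional geodesic foliation with local unit tangent field $T$ this is equivalent to $(\mathcal L_Tg)(U,V)=0$ for all $U,V\perp T$. For a one-dimensional totally geodesic foliation, $T$ denotes the unit field tangent to the leaves and $R_T:T^\perp\to T^\perp$, $R_T(U)=R(U,T)T$, the mixed-curvature operator, where $R(X,Y)Z=\nabla_X\nabla_YZ-\nabla_Y\nabla_XZ-\nabla_{[X,Y]}Z$ (so round spheres have positive curvature). The derivative $\nabla_T^\perp R_T$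 is taken in $\operatorname{End}(T^\perp)$ with the normal connection: $(\nabla_T^\perp R_T)U=\nabla_T^\perp(R_TU)-R_T(\nabla_T^\perp U)$, where $\nabla_T^\perp U$ is the component of $\nabla_TU$ orthogonal to $T$. *)

(* Defs.v *)
From HB Require Import structures.
From Stdlib Require Export Relations.
From mathcomp Require Export all_boot all_order all_algebra.
From mathcomp Require Export all_classical all_reals all_analysis.

Set Implicit Arguments.
Unset Strict Implicit.
Unset Printing Implicit Defensive.

Export Order.TTheory GRing.Theory Num.Theory.
Export numFieldNormedType.Exports.

Open Scope classical_set_scope.
Open Scope ring_scope.

(** ** C^oo maps between open subsets of R^n *)

Definition partial (R : realType) (n : nat) (i : 'I_n)
    (f : 'rV[R]_n -> R) : 'rV[R]_n -> R :=
  fun x => 'D_('e_i) f x.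

Definition iter_partial (R : realType) (n : nat) (s : seq 'I_n)
    (f : 'rV[R]_n -> R) : 'rV[R]_n -> R :=
  foldr (@partial R n) f s.

(* Only used with [A] open. *)
Definition smooth_on (R : realType) (n : nat) (A : set 'rV[R]_n)
    (f : 'rV[R]_n -> R) : Prop :=
  forall (s : seq 'I_n) (x : 'rV[R]_n), A x ->
    {for x, continuous (iter_partial s f)} /\
    (forall i, derivable (iter_partial s f) x 'e_i).

Definition smooth_vec_on (R : realType) (n m : nat) (A : set 'rV[R]_n)
    (f : 'rV[R]_n -> 'rV[R]_m) : Prop :=
  forall j, smooth_on A (fun x => f x 0 j).

(* Vectors are rows, so a vector [v] at [x] is pushed forward to
   [v *m jac f x]. *)
Definition jac (R : realType) (n m : nat) (f : 'rV[R]_n -> 'rV[R]_m)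
    (x : 'rV[R]_n) : 'M[R]_(n, m) :=
  \matrix_(i, j) partial i (fun z => f z 0 j) x.

(** ** Smooth manifolds *)

(* [cmap] and [cinv] are total functions, meaningful on [cdom] and on
   [cimg] respectively. *)
Record chart (R : realType) (n : nat) (M : topologicalType) := Chart {
  cdom : set M;
  cmap : M -> 'rV[R]_n;
  cinv : 'rV[R]_n -> M;
  cdom_open : open cdom;
  cimg_open : open (cmap @` cdom);
  cmapK : forall x, cdom x -> cinv (cmap x) = x;
  cmap_continuous : forall x, cdom x -> {for x, continuous cmap};
  cinv_continuous : forall y, (cmap @` cdom) y -> {for y, continuous cinv}
}.

Definition cimg (R : realType) (n : nat) (M : topologicalType)
    (c : chart R n M) : set 'rV[R]_n := cmap c @` cdom c.

Definition local_rep (R : realType) (n m : nat) (M B : topologicalType)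
    (c : chart R n M) (d : chart R m B) (f : M -> B) : 'rV[R]_n -> 'rV[R]_m :=
  fun y => cmap d (f (cinv c y)).

Definition transition (R : realType) (n : nat) (M : topologicalType)
    (c d : chart R n M) : 'rV[R]_n -> 'rV[R]_n := local_rep c d id.

Definition smooth_compatible (R : realType) (n : nat) (M : topologicalType)
    (c d : chart R n M) : Prop :=
  smooth_vec_on (cmap c @` (cdom c `&` cdom d)) (transition c d) /\
  smooth_vec_on (cmap d @` (cdom c `&` cdom d)) (transition d c).

Record manifold (R : realType) (n : nat) := Manifold {
  carrier :> topologicalType;
  atlas : set (chart R n carrier);
  carrier_hausdorff : hausdorff_space carrier;
  carrier_second_countable : @second_countable carrier;
  atlas_cover : forall x : carrier, exists2 c, atlas c & cdom c x;
  atlas_compatible : forall c d, atlas c -> atlas d -> smooth_compatible c d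
}.

(* There is no boundary since charts have open images in R^n; the empty
   manifold is excluded. *)
Definition closed_manifold (R : realType) (n : nat) (M : manifold R n) : Prop :=
  compact [set: M] /\ [set: M] !=set0.

Definition smooth_fun_on (R : realType) (n : nat) (M : manifold R n)
    (W : set M) (f : M -> R) : Prop :=
  forall c, atlas c ->
    smooth_on (cmap c @` (cdom c `&` W)) (fun y => f (cinv c y)).

Definition smooth_map_on (R : realType) (n m : nat)
    (M : manifold R n) (B : manifold R m) (W : set M) (f : M -> B) : Prop :=
  (forall x, W x -> {for x, continuous f}) /\
  (forall c d, atlas c -> atlas d ->
    smooth_vec_on (cmap c @` (cdom c `&` W `&` f @^-1` cdom d))
      (local_rep c d f)).

(** ** Smooth circle fibrations *)

(* Smoothness of [Psi : W x R -> M]; the coordinates on the source are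
   [row_mx y s%:M] with [y] coordinates in [B]. *)
Definition smooth_family_on (R : realType) (n m : nat)
    (M : manifold R n) (B : manifold R m) (W : set B)
    (Psi : B -> R -> M) : Prop :=
  (forall b s, W b -> {for (b, s), continuous (fun q : B * R => Psi q.1 q.2)}) /\
  (forall (d : chart R m B) (c : chart R n M), atlas d -> atlas c ->
    smooth_vec_on
      [set y : 'rV[R]_(m + 1) |
        (cmap d @` (cdom d `&` W)) (lsubmx y) /\
        cdom c (Psi (cinv d (lsubmx y)) (rsubmx y 0 0))]
      (fun y => cmap c (Psi (cinv d (lsubmx y)) (rsubmx y 0 0)))).

(* A diffeomorphism [(p, (th1, th2))] from [p^-1 W] onto [W x S^1], where S^1
   is the unit circle of R^2.  Its inverse is given as a map [Psi] from [W x R],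
   through the covering [s |-> (cos s, sin s)] of S^1. *)
Definition circle_trivialization (R : realType) (n m : nat)
    (M : manifold R n) (B : manifold R m) (p : M -> B) (W : set B)
    (th1 th2 : M -> R) (Psi : B -> R -> M) : Prop :=
  [/\ smooth_fun_on (p @^-1` W) th1 /\ smooth_fun_on (p @^-1` W) th2,
      forall x, W (p x) -> th1 x ^+ 2 + th2 x ^+ 2 = 1,
      smooth_family_on W Psi,
      forall b s, W b ->
        [/\ p (Psi b s) = b, th1 (Psi b s) = cos s & th2 (Psi b s) = sin s]
    & forall x s, W (p x) -> th1 x = cos s -> th2 x = sin s ->
        Psi (p x) s = x].

Definition circle_fibration (R : realType) (n m : nat)
    (M : manifold R n) (B : manifold R m) (p : M -> B) : Prop :=
  smooth_map_on setT p /\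
  forall b : B, exists W : set B, exists th1 th2 : M -> R,
  exists Psi : B -> R -> M,
    [/\ open W, W b & circle_trivialization p W th1 th2 Psi].

(** ** Riemannian metrics *)

Definition ip (R : realType) (n : nat) (G : 'M[R]_n) (u v : 'rV[R]_n) : R :=
  (u *m G *m v^T) 0 0.

(* [gm g c y] is the Gram matrix of the coordinate frame of the chart [c] at
   the point with coordinates [y]. *)
Record metric (R : realType) (n : nat) (M : manifold R n) := Metric {
  gm : chart R n M -> 'rV[R]_n -> 'M[R]_n;
  gm_smooth : forall c, atlas c ->
    forall i j, smooth_on (cimg c) (fun y => gm c y i j);
  gm_sym : forall c y, atlas c -> cimg c y -> (gm c y)^T = gm c y;
  gm_pos : forall c y u, atlas c -> cimg c y -> u != 0 -> 0 < ip (gm c y) u u;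
  gm_change : forall c d x, atlas c -> atlas d -> cdom c x -> cdom d x ->
    gm c (cmap c x) = jac (transition c d) (cmap c x) *m gm d (cmap d x)
                      *m (jac (transition c d) (cmap c x))^T
}.

(** ** Levi-Civita connection and curvature in coordinates

    Here [G : 'rV_n -> 'M_n] is the Gram matrix of a metric on an open subset
    of R^n, and vector fields are functions ['rV_n -> 'rV_n]. *)

Definition christoffel (R : realType) (n : nat) (G : 'rV[R]_n -> 'M[R]_n)
    (k i j : 'I_n) (y : 'rV[R]_n) : R :=
  2^-1 * \sum_l invmx (G y) k l *
    (partial i (fun z => G z j l) y + partial j (fun z => G z i l) y
     - partial l (fun z => G z i j) y).

Definition nabla (R : realType) (n : nat) (G : 'rV[R]_n -> 'M[R]_n)
    (X Y : 'rV[R]_n -> 'rV[R]_n) : 'rV[R]_n -> 'rV[R]_n :=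
  fun y => \row_k (\sum_i X y 0 i * partial i (fun z => Y z 0 k) y
    + \sum_i \sum_j christoffel G k i j y * X y 0 i * Y y 0 j).

Definition bracket (R : realType) (n : nat) (X Y : 'rV[R]_n -> 'rV[R]_n) :
    'rV[R]_n -> 'rV[R]_n :=
  fun y => \row_k \sum_i (X y 0 i * partial i (fun z => Y z 0 k) y
                          - Y y 0 i * partial i (fun z => X z 0 k) y).

Definition curv (R : realType) (n : nat) (G : 'rV[R]_n -> 'M[R]_n)
    (X Y Z : 'rV[R]_n -> 'rV[R]_n) : 'rV[R]_n -> 'rV[R]_n :=
  fun y => nabla G X (nabla G Y Z) y - nabla G Y (nabla G X Z) y
           - nabla G (bracket X Y) Z y.

(* Tangent vectors at a point are extended to fields with constant
   coefficients; by tensoriality of [curv] the extension is irrelevant. *)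
Definition sectional (R : realType) (n : nat) (G : 'rV[R]_n -> 'M[R]_n)
    (y u v : 'rV[R]_n) : R :=
  ip (G y) (curv G (fun=> u) (fun=> v) (fun=> v) y) u
  / (ip (G y) u u * ip (G y) v v - ip (G y) u v ^+ 2).

(** ** Foliations *)

(* A k-dimensional foliation is given by a foliated atlas, compatible with the
   smooth structure: the image of a foliated chart is a cube (balls of 'rV_n
   are balls for the sup norm), its plaques are the slices on which the last
   [n - k] coordinates are constant, and coordinate changes preserve these
   slices locally. *)
Record foliation (R : realType) (n : nat) (M : manifold R n) (k : nat) :=
    Foliation {
  fatlas : set (chart R n M);
  fatlas_cover : forall x, exists2 c, fatlas c & cdom c x;
  fatlas_smooth : forall c d, fatlas c -> atlas d -> smooth_compatible c d;
  fatlas_cube : forall c, fatlas c ->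
    exists x, exists2 r, 0 < r & cimg c = ball x r;
  fatlas_change : forall c d x (i j : 'I_n), fatlas c -> fatlas d ->
    cdom c x -> cdom d x -> (i < k)%N -> (k <= j)%N ->
    jac (transition c d) (cmap c x) i j = 0
}.

Definition same_plaque (R : realType) (n k : nat) (M : manifold R n)
    (F : foliation M k) (x y : M) : Prop :=
  exists c, [/\ fatlas F c, cdom c x, cdom c y
    & forall j : 'I_n, (k <= j)%N -> cmap c x 0 j = cmap c y 0 j].

Definition leaf (R : realType) (n k : nat) (M : manifold R n)
    (F : foliation M k) (x : M) : set M :=
  clos_refl_sym_trans M (same_plaque F) x.

(* [v], in the coordinates of the chart [c], is tangent to the leaf through
   the point with coordinates [y]. *)
Definition tangent (R : realType) (n k : nat) (M : manifold R n)
    (F : foliation M k) (c : chart R n M) (y v : 'rV[R]_n) : Prop :=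
  forall d, fatlas F d -> cdom d (cinv c y) ->
  forall j : 'I_n, (k <= j)%N -> (v *m jac (transition c d) y) 0 j = 0.

Definition totally_geodesic (R : realType) (n k : nat) (M : manifold R n)
    (g : metric M) (F : foliation M k) : Prop :=
  forall c, atlas c -> forall V : set 'rV[R]_n, open V -> V `<=` cimg c ->
  forall X Y : 'rV[R]_n -> 'rV[R]_n, smooth_vec_on V X -> smooth_vec_on V Y ->
  (forall y, V y -> tangent F c y (X y) /\ tangent F c y (Y y)) ->
  forall y, V y -> tangent F c y (nabla (gm g c) X Y y).

Definition orthogonal_to_leaf (R : realType) (n k : nat) (M : manifold R n)
    (g : metric M) (F : foliation M k) (c : chart R n M)
    (y u : 'rV[R]_n) : Prop :=
  forall v, tangent F c y v -> ip (gm g c y) u v = 0.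

Definition Kmix_positive (R : realType) (n k : nat) (M : manifold R n)
    (g : metric M) (F : foliation M k) : Prop :=
  forall c, atlas c -> forall y, cimg c y -> forall u t : 'rV[R]_n,
  u != 0 -> t != 0 -> orthogonal_to_leaf g F c y u -> tangent F c y t ->
  0 < sectional (gm g c) y u t.

Definition geodesic (R : realType) (n : nat) (M : manifold R n)
    (g : metric M) (gam : R -> M) : Prop :=
  continuous gam /\
  forall c, atlas c -> forall s, cdom c (gam s) ->
  let x (k : 'I_n) (r : R) : R := cmap c (gam r) 0 k in
  (forall k m, derivable (derive1n m (x k)) s 1) /\
  (forall k, derive1n 2 (x k) s + \sum_i \sum_j
     christoffel (gm g c) k i j (cmap c (gam s))
       * derive1 (x i) s * derive1 (x j) s = 0).

Definition closed_geodesic (R : realType) (n : nat) (M : manifold R n)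
    (g : metric M) (gam : R -> M) : Prop :=
  [/\ geodesic g gam,
      exists2 l, 0 < l & forall s, gam (s + l) = gam s
    & exists s, gam s <> gam 0].

Definition riemannian_submersion_on (R : realType) (n m : nat)
    (M : manifold R n) (g : metric M) (Q : manifold R m) (h : metric Q)
    (W : set M) (f : M -> Q) : Prop :=
  smooth_map_on W f /\
  forall x c d, W x -> atlas c -> atlas d -> cdom c x -> cdom d (f x) ->
  let J := jac (local_rep c d f) (cmap c x) in
  let G := gm g c (cmap c x) in
  let horizontal u := forall w, w *m J = 0 -> ip G u w = 0 in
  \rank J = m /\
  (forall u v, horizontal u -> horizontal v ->
    ip (gm h d (cmap d (f x))) (u *m J) (v *m J) = ip G u v).

(* The foliation is given on [W] by the fibers of [f] when its tangent spaces
   are the kernels of the differential of [f]. *)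
Definition bundle_like (R : realType) (n k : nat) (M : manifold R n)
    (g : metric M) (F : foliation M k) : Prop :=
  forall p : M, exists W : set M, [/\ open W, W p &
  exists (Q : manifold R (n - k)) (h : metric Q) (f : M -> Q),
    riemannian_submersion_on g h W f /\
    forall x c d, W x -> atlas c -> atlas d -> cdom c x -> cdom d (f x) ->
    forall v, tangent F c (cmap c x) v <->
              v *m jac (local_rep c d f) (cmap c x) = 0].

(** ** Mixed curvature of a one-dimensional foliation *)

(* [T] is a smooth unit field tangent to the leaves on the open subset [V] of
   the image of the chart [c]. *)
Definition unit_tangent_field (R : realType) (n : nat) (M : manifold R n)
    (g : metric M) (F : foliation M 1) (c : chart R n M) (V : set 'rV[R]_n)
    (T : 'rV[R]_n -> 'rV[R]_n) : Prop :=
  smooth_vec_on V T /\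
  forall y, V y -> tangent F c y (T y) /\ ip (gm g c y) (T y) (T y) = 1.

Definition RT (R : realType) (n : nat) (G : 'rV[R]_n -> 'M[R]_n)
    (T U : 'rV[R]_n -> 'rV[R]_n) : 'rV[R]_n -> 'rV[R]_n :=
  curv G U T T.

Definition nabla_perp (R : realType) (n : nat) (G : 'rV[R]_n -> 'M[R]_n)
    (T U : 'rV[R]_n -> 'rV[R]_n) : 'rV[R]_n -> 'rV[R]_n :=
  fun y => nabla G T U y - ip (G y) (nabla G T U y) (T y) *: T y.

Definition RT_parallel_on (R : realType) (n : nat) (G : 'rV[R]_n -> 'M[R]_n)
    (V : set 'rV[R]_n) (T : 'rV[R]_n -> 'rV[R]_n) : Prop :=
  forall U : 'rV[R]_n -> 'rV[R]_n, smooth_vec_on V U ->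
  (forall y, V y -> ip (G y) (U y) (T y) = 0) ->
  forall y, V y ->
    nabla_perp G T (RT G T U) y - RT G T (nabla_perp G T U) y = 0.

(* The matrix of [u |-> R(u, T) T] on the whole tangent space. *)
Definition RT_mx (R : realType) (n : nat) (G : 'rV[R]_n -> 'M[R]_n)
    (T : 'rV[R]_n -> 'rV[R]_n) (y : 'rV[R]_n) : 'M[R]_n :=
  lin1_mx (fun u => RT G T (fun=> u) y).

(* The eigenspace of [R_T : T^perp -> T^perp] for [a], as a row space;
   [kermx (G y *m (T y)^T)] is [T^perp]. *)
Definition RT_eigenspace (R : realType) (n : nat) (G : 'rV[R]_n -> 'M[R]_n)
    (T : 'rV[R]_n -> 'rV[R]_n) (y : 'rV[R]_n) (a : R) : 'M[R]_n :=
  (eigenspace (RT_mx G T y) a :&: kermx (G y *m (T y)^T))%MS.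

Definition RT_spectrum (R : realType) (n : nat) (G : 'rV[R]_n -> 'M[R]_n)
    (T : 'rV[R]_n -> 'rV[R]_n) (y : 'rV[R]_n) : set R :=
  [set a | RT_eigenspace G T y a != 0].

(* Main.v *)
From HB Require Import structures.
Require Import Defs.
From mathcomp Require Import ring lra zify generic_quotient.

(* The metric transverse to a geodesic foliation is governed by Jacobi fields:
   if R_T is parallel with eigenvalues 1/4 (N - 2 times) and 1, then, at time t
   along a leaf, a tangent vector v of the leaf space has squared length
   |A_t v|^2, where A_t'' + R_T A_t = 0, and d theta (v, w), for theta dual to
   T, is the Wronskian <A_t' v, A_t w> - <A_t v, A_t' w>, which is constant in
   t.  On the Heisenberg group with coordinates (s, r), r = (x, y, r'), put
     z = ds - r J dr^T,  w = dx + i dy,  theta = dt + z.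
   The Jacobi field with components
     e^(-it/2) w - e^(it/2) z  (complex, frequency 1/2),
     Re (e^(-it) w)            (real, frequency 1),
     sqrt 2 dr', rotated with frequency 1/2
   is injective for every t and has Wronskian d theta, so
     g = theta^2 + |e^(-it) w - z|^2 + Re (e^(-it) w)^2 + 2 |dr'|^2
   has the required mixed curvature, with T = d/dt.  It is 2 pi-periodic in t
   and left invariant, hence lives on S^1 x (Heisenberg nilmanifold), whose
   leaves are the circles; it depends on t, so it is not bundle-like. *)

Set Implicit Arguments.
Unset Strict Implicit.
Unset Printing Implicit Defensive.

(** * Germs of smooth functions and trigonometric polynomials *)

Section Calculus.
Context {R : realType}.

(** The Jacobi field is arranged so that its Wronskian sees neither t nor z. In the first component
    w and z turn in opposite senses, so their cross terms cancel, and z, being real, contributes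
    nothing by itself; w contributes - dx ^ dy, and the component of frequency 1 contributes - dx ^
    dy once more. The cross term does survive in the metric, as - 2 z Re (e^(-it) w), and this is
    what moves transverse lengths with t. Injectivity holds because the first component vanishes
    only if e^(-it) w is the real number z, and then the second component equals z. The half
    frequencies disappear from norms, whence the period 2 pi. In the coframe theta, z - Re u, Re u,
    Im u, dr' with u = e^(-it) w, all data along a leaf become constant matrices: the Koszul
    formula, the Riccati equation and the parallelism of R_T turn into identities between 4 x 4
    blocks, plus one block for the pairs r'. Since R_T is built from nabla_U T and nabla_T, only the
    Christoffel symbols with an index t have to be computed. *)

Lemma near_all (n : nat) (x : 'rV[R]_n) (P : 'rV[R]_n -> Prop) :
  (forall z, P z) -> \forall z \near x, P z.
Proof. by move=> h; exact: filterS (fun z _ => h z) filterT. Qed.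

(** Smoothness at a point depends on the germ only ([near_smooth_at]), so a map may be replaced by
    its affine expression near each point. *)
Definition smooth_at (n : nat) (x : 'rV[R]_n) (f : 'rV[R]_n -> R) : Prop :=
  forall s : seq 'I_n, {for x, continuous (iter_partial s f)} /\
    (forall i, derivable (iter_partial s f) x 'e_i).

Lemma smooth_onE (n : nat) (A : set 'rV[R]_n) f :
  smooth_on A f <-> forall x, A x -> smooth_at x f.
Proof. by split=> h; [move=> x Ax s|move=> s x Ax]; exact: h. Qed.

Lemma near_partial (n : nat) (i : 'I_n) (f g : 'rV[R]_n -> R) (x : 'rV[R]_n) :
  {near x, f =1 g} -> {near x, partial i f =1 partial i g}.
Proof.
(* Agreement near x is agreement near every point close to x, which lets the induction over iterated
   partials go on. *)
move=> /near_join fg; near=> y; rewrite /partial.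
by apply: near_eq_derive; near: y.
Unshelve. all: by end_near. Qed.

Lemma near_iter_partial (n : nat) s (f g : 'rV[R]_n -> R) (x : 'rV[R]_n) :
  {near x, f =1 g} -> {near x, iter_partial s f =1 iter_partial s g}.
Proof. by move=> fg; elim: s => //= i s ih; exact: near_partial. Qed.

Lemma near_smooth_at (n : nat) (f g : 'rV[R]_n -> R) (x : 'rV[R]_n) :
  {near x, f =1 g} -> smooth_at x f -> smooth_at x g.
Proof.
move=> fg sf s; have [cf df] := sf s.
have nfg := near_iter_partial s fg; split.
  have e := nbhs_singleton nfg.
  change (iter_partial s g @ x --> iter_partial s g x).
  rewrite -e; apply: cvg_trans cf.
  exact: near_eq_cvg nfg.
by move=> i; exact: near_eq_derivable (df i).
Qed.

(** An algebra closed under partial derivatives that contains the entries of the coframe and of the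
    metric, so that differentiability of its members already gives smoothness of every order. *)
Inductive trigpoly (n : nat) : ('rV[R]_n -> R) -> Prop :=
| tp_cst c : trigpoly (fun=> c)
| tp_coord i : trigpoly (fun y => y 0 i)
| tp_cos i : trigpoly (fun y => cos (y 0 i))
| tp_sin i : trigpoly (fun y => sin (y 0 i))
| tp_add f g : trigpoly f -> trigpoly g -> trigpoly (fun y => f y + g y)
| tp_mul f g : trigpoly f -> trigpoly g -> trigpoly (fun y => f y * g y).

Lemma trigpolyN (n : nat) (f : 'rV[R]_n -> R) :
  trigpoly f -> trigpoly (fun y => - f y).
Proof.
move=> tf; have := tp_mul (tp_cst n (-1)) tf.
by congr trigpoly; apply/funext => y; rewrite mulN1r.
Qed.

Lemma trigpolyB (n : nat) (f g : 'rV[R]_n -> R) :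
  trigpoly f -> trigpoly g -> trigpoly (fun y => f y - g y).
Proof. by move=> tf tg; apply: tp_add => //; exact: trigpolyN. Qed.

Lemma trigpoly_sum (n : nat) (I : Type) (r : seq I) (f : I -> 'rV[R]_n -> R) :
  (forall i, trigpoly (f i)) -> trigpoly (fun y => \sum_(i <- r) f i y).
Proof.
move=> tf; elim: r => [|a r ih].
  by under eq_fun do rewrite big_nil; exact: tp_cst.
by under eq_fun do rewrite big_cons; exact: tp_add.
Qed.

Lemma derive_comp1 (n : nat) (g : R -> R) (f : 'rV[R]_n -> R) x v (dg : R) :
  is_derive (f x) 1 g dg -> differentiable f x ->
  is_derive x v (g \o f) (dg * 'D_v f x).
Proof.
move=> [dgx <-] df; have dg1 := (iffLR (derivable1_diffP _ _)) dgx.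
have dc := differentiable_comp df dg1.
apply: DeriveDef; first exact: diff_derivable.
rewrite (deriveE _ dc) diff_comp//= (deriveE _ dg1) (deriveE _ df).
by rewrite -[X in 'd g _ X]mulr1 [LHS]linearZ /= mulrC.
Qed.

Lemma trigpoly_differentiable (n : nat) (f : 'rV[R]_n -> R) x :
  trigpoly f -> differentiable f x.
Proof.
elim=> {f}[c|i|i|i|f g _ df _ dg|f g _ df _ dg].
- exact: differentiable_cst.
- exact: differentiable_coord.
- apply: (@differentiable_comp _ _ _ _ (fun y : 'rV[R]_n => y 0 i) cos).
    exact: differentiable_coord.
  exact/derivable1_diffP/derivable_cos.
- apply: (@differentiable_comp _ _ _ _ (fun y : 'rV[R]_n => y 0 i) sin).
    exact: differentiable_coord.
  exact/derivable1_diffP/derivable_sin.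
- exact: differentiableD.
- exact: differentiableM.
Qed.

Lemma trigpoly_derivable (n : nat) (f : 'rV[R]_n -> R) x v :
  trigpoly f -> derivable f x v.
Proof. by move=> tf; exact/diff_derivable/trigpoly_differentiable. Qed.

Lemma partial_cst (n : nat) i (c : R) :
  partial i (fun _ : 'rV[R]_n => c) = fun=> 0.
Proof. by apply/funext => x; rewrite /partial derive_cst. Qed.

Lemma partial_coord (n : nat) i j :
  partial i (fun y : 'rV[R]_n => y 0 j) = fun=> (i == j)%:R.
Proof.
apply/funext => x; rewrite /partial deriveE; last exact: differentiable_coord.
pose f (y : 'rV[R]_n) : R := y 0 j.
have lf : linear f by move=> k u v; rewrite /f !mxE.
pose fL := GRing.isLinear.Build _ _ _ _ f lf.
pose F : {linear 'rV[R]_n -> R} := HB.pack f fL.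
rewrite (_ : (fun y => _) = F)// diff_lin /=; last exact: coord_continuous.
by rewrite /f mxE eqxx eq_sym.
Qed.

Lemma partialD (n : nat) i (f g : 'rV[R]_n -> R) (x : 'rV[R]_n) :
  derivable f x 'e_i -> derivable g x 'e_i ->
  partial i (fun y => f y + g y) x = partial i f x + partial i g x.
Proof. by move=> df dg; exact: (deriveD df dg). Qed.

Lemma partialM (n : nat) i (f g : 'rV[R]_n -> R) (x : 'rV[R]_n) :
  derivable f x 'e_i -> derivable g x 'e_i ->
  partial i (fun y => f y * g y) x = f x * partial i g x + g x * partial i f x.
Proof. by move=> df dg; rewrite /partial deriveM. Qed.

Lemma partial_sum (n : nat) i (I : Type) (r : seq I) (f : I -> 'rV[R]_n -> R) x :
  (forall k, derivable (f k) x 'e_i) ->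
  derivable (fun y => \sum_(k <- r) f k y) x 'e_i /\
  partial i (fun y => \sum_(k <- r) f k y) x = \sum_(k <- r) partial i (f k) x.
Proof.
move=> df; elim: r => [|a r [ih1 ih2]].
  under eq_fun do rewrite big_nil.
  by rewrite partial_cst big_nil; split=> //; exact: derivable_cst.
under eq_fun do rewrite big_cons; split; first exact: derivableD (df a) ih1.
by rewrite (partialD (df a) ih1) big_cons ih2.
Qed.

Lemma partial_cos (n : nat) i j (x : 'rV[R]_n) :
  partial i (fun y : 'rV[R]_n => cos (y 0 j)) x = - sin (x 0 j) * (i == j)%:R.
Proof.
have dj := @differentiable_coord R _ _ x 0 j.
have [_ e] := @derive_comp1 n cos (fun y => y 0 j) x 'e_i _ (is_derive_cos _) dj.
apply: etrans e _; congr (_ * _).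
by rewrite -[LHS]/(partial i (fun y => y 0 j) x) partial_coord.
Qed.

Lemma partial_sin (n : nat) i j (x : 'rV[R]_n) :
  partial i (fun y : 'rV[R]_n => sin (y 0 j)) x = cos (x 0 j) * (i == j)%:R.
Proof.
have dj := @differentiable_coord R _ _ x 0 j.
have [_ e] := @derive_comp1 n sin (fun y => y 0 j) x 'e_i _ (is_derive_sin _) dj.
apply: etrans e _; congr (_ * _).
by rewrite -[LHS]/(partial i (fun y => y 0 j) x) partial_coord.
Qed.

Lemma trigpoly_partial (n : nat) i (f : 'rV[R]_n -> R) :
  trigpoly f -> trigpoly (partial i f).
Proof.
elim=> {f}[c|j|j|j|f g tf tf' tg tg'|f g tf tf' tg tg'].
- by rewrite partial_cst; exact: tp_cst.
- by rewrite partial_coord; exact: tp_cst.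
- rewrite (_ : partial _ _ = fun y => - sin (y 0 j) * (i == j)%:R).
    by apply: tp_mul (tp_cst _ _); apply/trigpolyN/tp_sin.
  by apply/funext => y; rewrite partial_cos.
- rewrite (_ : partial _ _ = fun y => cos (y 0 j) * (i == j)%:R).
    by apply: tp_mul (tp_cst _ _); apply/tp_cos.
  by apply/funext => y; rewrite partial_sin.
- rewrite (_ : partial _ _ = fun y => partial i f y + partial i g y).
    exact: tp_add.
  by apply/funext => y; rewrite partialD//; exact: trigpoly_derivable.
- rewrite (_ : partial _ _ = fun y => f y * partial i g y + g y * partial i f y).
    by apply: tp_add; exact: tp_mul.
  by apply/funext => y; rewrite partialM//; exact: trigpoly_derivable.
Qed.

Lemma trigpoly_smooth (n : nat) (f : 'rV[R]_n -> R) x :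
  trigpoly f -> smooth_at x f.
Proof.
move=> tf s; have ts : trigpoly (iter_partial s f).
  by elim: s => //= i s; exact: trigpoly_partial.
split; first exact/differentiable_continuous/trigpoly_differentiable.
by move=> i; exact: trigpoly_derivable.
Qed.

Lemma trigpoly_continuous (n : nat) (f : 'rV[R]_n -> R) :
  trigpoly f -> continuous f.
Proof.
by move=> tf x; exact/differentiable_continuous/trigpoly_differentiable.
Qed.

Lemma rV_continuous_at (T : topologicalType) m n (f : T -> 'M[R]_(m, n)) x :
  (forall i j, {for x, continuous (fun t => f t i j)}) ->
  {for x, continuous f}.
Proof.
move=> cf A [B nB sBA]; rewrite /nbhs/=.
have : \near x, forall i j, B i j (f x i j).
  by apply: filter_forall => i; apply: filter_forall => j; apply: cf; exact: nB.
by apply: filterS => y By; exact: sBA.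
Qed.

Lemma cvg_sumR (T : Type) (F : set_system T) {FF : Filter F} (I : Type)
    (r : seq I) (f : I -> T -> R) (l : I -> R) :
  (forall k, f k @ F --> l k) ->
  (fun t => \sum_(k <- r) f k t) @ F --> \sum_(k <- r) l k.
Proof.
move=> fl; elim: r => [|a r ih].
  by under eq_fun do rewrite big_nil; rewrite big_nil; exact: cvg_cst.
by under eq_fun do rewrite big_cons; rewrite big_cons; exact: cvgD.
Qed.

Lemma ball_rVE n (x y : 'rV[R]_n) (r : R) : 0 < r ->
  ball x r y <-> forall i, `|x 0 i - y 0 i| < r.
Proof.
move=> r0; split=> [[_ h] i|h]; first exact: h.
by split=> // i j; rewrite ord1; exact: h.
Qed.

Lemma trigpoly_affine n m (A : 'M[R]_(n, m)) (v : 'rV[R]_m) j :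
  trigpoly (fun y => (y *m A + v) 0 j).
Proof.
under eq_fun do rewrite !mxE.
apply: tp_add (tp_cst _ _); apply: trigpoly_sum => i.
exact: tp_mul (tp_coord _) (tp_cst _ _).
Qed.

Lemma affine_continuous n m (A : 'M[R]_(n, m)) (v : 'rV[R]_m) :
  continuous (fun y : 'rV[R]_n => y *m A + v).
Proof.
move=> y; apply: rV_continuous_at => i j; rewrite ord1.
exact/trigpoly_continuous/trigpoly_affine.
Qed.

(** Transition maps are left translations near each point, hence affine; this evaluates their
    Jacobians. *)
Lemma jac_affine n m (A : 'M[R]_(n, m)) (v : 'rV[R]_m) (f : 'rV[R]_n ->
  'rV[R]_m) (x : 'rV[R]_n) :
  {near x, f =1 (fun y => y *m A + v)} -> jac f x = A.
Proof.
move=> fA; apply/matrixP => i j; rewrite mxE.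
have /nbhs_singleton -> : {near x, partial i (fun z => f z 0 j)
    =1 partial i (fun z => (z *m A + v) 0 j)}.
  by apply: near_partial; apply: filterS fA => y /= ->.
under eq_fun do rewrite !mxE.
have dz k : derivable (fun z : 'rV[R]_n => z 0 k * A k j) x 'e_i.
  exact/trigpoly_derivable/tp_mul/tp_cst/tp_coord.
have partialZ k : partial i (fun z : 'rV[R]_n => z 0 k * A k j) x =
    A k j * (i == k)%:R.
  have dk : derivable (fun z : 'rV[R]_n => z 0 k) x 'e_i.
    exact/trigpoly_derivable/tp_coord.
  have dc : derivable (fun _ : 'rV[R]_n => A k j) x 'e_i by exact: derivable_cst.
  by rewrite (partialM dk dc) partial_cst partial_coord mulr0 add0r.
have [d1 d2] := partial_sum (index_enum 'I_n) dz.
have d3 : derivable (fun _ : 'rV[R]_n => v 0 j) x 'e_i by exact: derivable_cst.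
rewrite (partialD d1 d3).
rewrite partial_cst addr0 d2 (bigD1 i)//= big1 ?addr0.
  by rewrite partialZ eqxx mulr1.
by move=> k ki; rewrite partialZ eq_sym (negbTE ki) mulr0.
Qed.

End Calculus.


(** * Heisenberg groups and their nilmanifolds *)

(* The group law [hmul] is v y = v + y + (v J y^T) e_z, and the i-th coordinates
   of the lattice are the multiples of [hper i]. *)
Record heis (R : realType) (n : nat) := Heis {
  hJ : 'M[R]_n;
  hz : 'I_n;
  hper : 'I_n -> R;
  hJ_antisym : hJ^T = - hJ;
  hJ_center : forall i, hJ hz i = 0;
  hper_ge1 : forall i, 1 <= hper i;
  hJ_int : forall v w : 'rV[R]_n,
    (forall i, exists k : int, v 0 i = hper i * k%:~R) ->
    (forall i, exists k : int, w 0 i = hper i * k%:~R) ->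
    exists k : int, (v *m hJ *m w^T) 0 0 = hper hz * k%:~R
}.

Section HeisenbergGroup.
Local Open Scope quotient_scope.
Context {R : realType} {n : nat} (H : heis R n).
Local Notation J := (hJ H).
Local Notation z := (hz H).
Implicit Types v w x y : 'rV[R]_n.

Definition hlat : set 'rV[R]_n :=
  [set v | forall i, exists k : int, v 0 i = hper H i * k%:~R].

Definition hform v w : R := (v *m J *m w^T) 0 0.

Definition hmul v y : 'rV[R]_n := v + y + hform v y *: 'e_z.

(** Linear part of the affine map [hmul v], acting on rows from the right ([hmulE]). *)
Definition hlin v : 'M[R]_n := 1%:M + (v *m J)^T *m 'e_z.

Lemma hJ_center_r i : J i z = 0.
Proof.
have /matrixP/(_ z i) := hJ_antisym H.
by rewrite !mxE hJ_center oppr0.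
Qed.

Lemma hJ_ez : J *m ('e_z)^T = 0 :> 'cV[R]_n.
Proof.
apply/colP => i; rewrite !mxE (bigD1 z)//= hJ_center_r mul0r add0r big1//.
by move=> k kz; rewrite !mxE eqxx (negbTE kz) mulr0.
Qed.

Lemma hez_J : 'e_z *m J = 0 :> 'rV[R]_n.
Proof. by rewrite -rowE; apply/rowP => i; rewrite !mxE hJ_center. Qed.

Lemma hformDl u v w : hform (u + v) w = hform u w + hform v w.
Proof. by rewrite /hform !mulmxDl mxE. Qed.

Lemma hformDr u v w : hform u (v + w) = hform u v + hform u w.
Proof. by rewrite /hform linearD/= mulmxDr mxE. Qed.

Lemma hform_zl v a : hform (a *: 'e_z) v = 0.
Proof. by rewrite /hform -!scalemxAl hez_J mul0mx scaler0 mxE. Qed.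

Lemma hform_zr v a : hform v (a *: 'e_z) = 0.
Proof. by rewrite /hform linearZ/= -scalemxAr -mulmxA hJ_ez mulmx0 scaler0 mxE. Qed.

Lemma hformC v w : hform v w = - hform w v.
Proof.
have e : (v *m J *m w^T)^T = - (w *m J *m v^T).
  by rewrite !trmx_mul trmxK hJ_antisym mulmxA mulmxN mulNmx.
by have /matrixP/(_ 0 0) := e; rewrite [LHS]mxE [RHS]mxE.
Qed.

Lemma hformvv v : hform v v = 0.
Proof. by have := hformC v v; lra. Qed.

Lemma hformNl v w : hform (- v) w = - hform v w.
Proof. by rewrite /hform !mulNmx mxE. Qed.

(** The form is bilinear and vanishes on the centre, so central terms do not feed back into the
    product. *)
Lemma hmulA u v w : hmul u (hmul v w) = hmul (hmul u v) w.
Proof.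
rewrite /hmul !hformDr !hformDl hform_zl hform_zr !addr0.
by apply/rowP => i; rewrite !mxE; ring.
Qed.

Lemma hmul0 v : hmul 0 v = v.
Proof. by rewrite /hmul /hform !mul0mx mxE scale0r add0r addr0. Qed.

Lemma hmulN v : hmul (- v) v = 0.
Proof. by rewrite /hmul hformNl hformvv oppr0 scale0r addr0 addNr. Qed.

Lemma hmulKV v w : hmul (- v) (hmul v w) = w.
Proof. by rewrite hmulA hmulN hmul0. Qed.

(** The group quotient of w by y is polynomial in the pair, hence continuous; separation of points
    in the quotient space rests on this. *)
Lemma hmul_inv_r v y w : w = hmul v y -> v = w - y - hform w y *: 'e_z.
Proof.
move=> ->; rewrite /hmul !hformDl hform_zl hformvv !addr0.
by apply/rowP => i; rewrite !mxE; ring.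
Qed.

Lemma hmulE v y : hmul v y = y *m hlin v + v.
Proof.
have e : y *m (v *m J)^T = (hform v y)%:M.
  rewrite [LHS]mx11_scalar; congr (_%:M).
  by rewrite -[y in LHS]trmxK -trmx_mul mxE.
by rewrite /hlin mulmxDr mulmx1 mulmxA e mul_scalar_mx /hmul
   [RHS]addrC addrA.
Qed.

Lemma hmul_continuous v : continuous (hmul v).
Proof.
have -> : hmul v = fun y => y *m hlin v + v by apply/funext => y; exact: hmulE.
exact: affine_continuous.
Qed.

Lemma hlat0 : hlat 0.
Proof. by move=> i; exists 0; rewrite mxE mulr0. Qed.

Lemma hlatN v : hlat v -> hlat (- v).
Proof.
by move=> lv i; have [k vk] := lv i; exists (- k); rewrite mxE vk rmorphN mulrN.
Qed.

Lemma hlatM v w : hlat v -> hlat w -> hlat (hmul v w).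
Proof.
move=> lv lw i; have [k vk] := lv i; have [l wl] := lw i.
have [b fb] : exists k : int, hform v w = hper H z * k%:~R by exact: hJ_int.
rewrite !mxE vk wl fb eqxx /=; have [->|_] := eqVneq i z.
  by exists (k + l + b); rewrite !rmorphD /= mulr1; ring.
by exists (k + l); rewrite rmorphD /= mulr0; ring.
Qed.

Lemma hlat_small v i : hlat v -> `|v 0 i| < 1 -> v 0 i = 0.
Proof.
move=> /(_ i)[k ->]; have p1 := hper_ge1 H i.
rewrite normrM (ger0_norm (le_trans ler01 p1)) => lt1.
have : `|k%:~R : R| < 1.
  by apply: le_lt_trans lt1; rewrite ler_peMl.
rewrite -intr_norm -[1]/(1%:~R) ltr_int => kl.
have : `|k| <= 0 by rewrite -ltzD1 add0r.
by rewrite normr_le0 => /eqP ->; rewrite mulr0.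
Qed.

Definition heqv : rel 'rV[R]_n :=
  fun x y => `[< exists2 v, hlat v & y = hmul v x >].

Lemma heqv_refl : reflexive heqv.
Proof. by move=> x; apply/asboolP; exists 0; [exact: hlat0|rewrite hmul0]. Qed.

Lemma heqv_sym : symmetric heqv.
Proof.
suff h x y : heqv x y -> heqv y x by move=> x y; apply/idP/idP; exact: h.
move=> /asboolP[v lv ->]; apply/asboolP; exists (- v); first exact: hlatN.
by rewrite hmulKV.
Qed.

Lemma heqv_trans : transitive heqv.
Proof.
move=> y x w /asboolP[v lv ->] /asboolP[u lu ->]; apply/asboolP.
by exists (hmul u v); [exact: hlatM|rewrite hmulA].
Qed.

Canonical heqv_equiv := EquivRel heqv heqv_refl heqv_sym heqv_trans.

Definition hspace : topologicalType := quotient_topology {eq_quot heqv}.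

Definition hpi : 'rV[R]_n -> hspace := \pi_hspace.

Definition hrep : hspace -> 'rV[R]_n := repr.

Lemma hrepK m : hpi (hrep m) = m.
Proof. by rewrite /hpi /hrep reprK. Qed.

Lemma hpiP x y : hpi x = hpi y <-> exists2 v, hlat v & y = hmul v x.
Proof.
have e : (x == y %[mod {eq_quot heqv}]) = heqv x y by exact: eqmodE.
split=> h; first by apply/asboolP; rewrite -[asbool _]e; exact/eqP.
have /eqP : x == y %[mod {eq_quot heqv}] by rewrite e; exact/asboolP.
exact.
Qed.

Lemma hpi_mul v x : hlat v -> hpi (hmul v x) = hpi x.
Proof. by move=> lv; apply/esym/hpiP; exists v. Qed.

Lemma hpi_continuous : continuous hpi.
Proof. exact: pi_continuous. Qed.

Lemma hpi_open A : open A -> open (hpi @` A).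
Proof.
move=> oA; change (open (hpi @^-1` (hpi @` A))).
rewrite (_ : _ @^-1` _ = \bigcup_(v in hlat) (hmul v @^-1` A)).
  apply: bigcup_open => v _; apply: open_comp => // y _.
  exact: hmul_continuous.
apply/seteqP; split=> [y /= [x Ax /esym/hpiP[v lv e]]|y [v lv Ay]].
  by exists v => //=; rewrite -e.
by exists (hmul v y) => //; exact: hpi_mul.
Qed.

Lemma hpi_nbhs x A : nbhs x A -> nbhs (hpi x) (hpi @` A).
Proof.
move=> nA; apply: (@filterS _ _ _ (hpi @` A^°)).
  by apply: image_subset; exact: interior_subset.
have oA : open (hpi @` A^°) by apply: hpi_open; exact: open_interior.
by apply: open_nbhs_nbhs; split=> //; exists x.
Qed.

(* Two equivalent points at distance less than 1 agree in all coordinates but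
   the central one, so the group form vanishes on them. *)
Lemma hpi_inj x y : hpi x = hpi y -> (forall i, `|y 0 i - x 0 i| < 1) -> x = y.
Proof.
move=> /hpiP[v lv yE] close.
have v0 i : i != z -> v 0 i = 0.
  move=> iz; apply: (hlat_small lv); have := close i.
  by rewrite yE !mxE eqxx (negbTE iz) mulr0 addr0 addrK.
have vE : v = v 0 z *: 'e_z.
  apply/rowP => i; rewrite !mxE eqxx; have [->|/v0->] := eqVneq i z.
    by rewrite mulr1.
  by rewrite mulr0.
have yE' : y = v + x by rewrite yE /hmul {2}vE hform_zl scale0r addr0.
have vz : v 0 z = 0.
  by apply: (hlat_small lv); have := close z; rewrite yE' !mxE addrK.
by rewrite yE' vE vz scale0r add0r.
Qed.

End HeisenbergGroup.

(** * Charts, separation, compactness and countability of the nilmanifold *)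

Section HeisenbergManifold.
Context {R : realType} {n : nat} (H : heis R n).
Local Notation M := (hspace H).
Local Notation pi := (@hpi R n H).
Implicit Types v w x y : 'rV[R]_n.

(** With radius 1/2, two points of the ball differ by less than 1 in each coordinate, the scale at
    which [hpi_inj] applies. *)
Definition hdom x : set M := pi @` ball x 2^-1.

Definition hsec x (m : M) : 'rV[R]_n := xget x [set y | ball x 2^-1 y /\ pi y = m].

Lemma half_close x y y' : ball x 2^-1 y -> ball x 2^-1 y' ->
  forall i, `|y' 0 i - y 0 i| < 1.
Proof.
have h0 : 0 < 2^-1 :> R by [].
move=> /(ball_rVE _ _ h0) xy /(ball_rVE _ _ h0) xy' i.
have {xy} a := xy i; have {xy'} b := xy' i.
have -> : y' 0 i - y 0 i = (x 0 i - y 0 i) - (x 0 i - y' 0 i) by ring.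
by apply: le_lt_trans (ler_normB _ _) _; lra.
Qed.

Lemma hsecK x y : ball x 2^-1 y -> hsec x (pi y) = y.
Proof.
move=> xy; have [xs /hpi_inj e] : [set y' | ball x 2^-1 y' /\ pi y' = pi y]
  (hsec x (pi y)) by apply: xgetPex; exists y.
exact: (e (half_close xs xy)).
Qed.

Lemma hsecP x m : hdom x m -> ball x 2^-1 (hsec x m) /\ pi (hsec x m) = m.
Proof. by move=> [y xy <-]; rewrite hsecK. Qed.

Lemma hdom_open x : open (hdom x).
Proof. by apply: hpi_open; exact: ball_open. Qed.

Lemma hsec_img x : hsec x @` hdom x = ball x 2^-1.
Proof.
apply/seteqP; split=> [_ [m [y xy <-] <-]|y xy]; first by rewrite hsecK.
by exists (pi y); [exists y|rewrite hsecK].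
Qed.

Lemma hsec_img_open x : open (hsec x @` hdom x).
Proof. by rewrite hsec_img; exact: ball_open. Qed.

Lemma hsec_pi x m : hdom x m -> pi (hsec x m) = m.
Proof. by move=> /hsecP[]. Qed.

Lemma hsec_continuous x m : hdom x m -> {for m, continuous (hsec x)}.
Proof.
move=> [y xy <-] A; rewrite hsecK// => nA.
have nB : nbhs y (A `&` ball x 2^-1).
  by apply: filterI => //; apply: open_nbhs_nbhs; split=> //; exact: ball_open.
change (nbhs (pi y) (hsec x @^-1` A)).
apply: filterS (hpi_nbhs H nB) => _ [y' [Ay' xy'] <-].
by rewrite /= hsecK.
Qed.

Lemma hpi_continuous_img x y : (hsec x @` hdom x) y -> {for y, continuous pi}.
Proof. by move=> _; exact: hpi_continuous. Qed.

Definition hchart x : chart R n M :=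
  Chart (@hdom_open x) (@hsec_img_open x) (@hsec_pi x) (@hsec_continuous x)
    (@hpi_continuous_img x).

(* The local sections of [pi] differ by lattice translations. *)
Lemma hsec_near x y : hdom x (pi y) ->
  exists2 v, hlat H v & \forall y' \near y, hsec x (pi y') = hmul H v y'.
Proof.
move=> dy; have [xs es] := hsecP dy.
have /hpiP[v lv e] := esym es.
exists v => //; have nb : nbhs (hmul H v y) (ball x 2^-1).
  by apply: open_nbhs_nbhs; split=> //; [exact: ball_open|rewrite -e].
have nv : \forall y' \near y, ball x 2^-1 (hmul H v y').
  exact: (@hmul_continuous R n H v y _ nb).
apply: filterS nv => y' xy'.
by rewrite -(hpi_mul y' lv) hsecK.
Qed.

Lemma smooth_at_affine m (f : 'rV[R]_n -> 'rV[R]_m) (A : 'M[R]_(n, m)) b x :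
  {near x, f =1 (fun y => y *m A + b)} ->
  forall j, smooth_at x (fun y => f y 0 j).
Proof.
move=> fA j; apply: (@near_smooth_at _ _ (fun y => (y *m A + b) 0 j)).
  by apply: filterS fA => y ->.
exact/trigpoly_smooth/trigpoly_affine.
Qed.

Lemma hchart_compatible x x' : smooth_compatible (hchart x) (hchart x').
Proof.
suff h a b : smooth_vec_on
    (cmap (hchart a) @` (cdom (hchart a) `&` cdom (hchart b)))
    (transition (hchart a) (hchart b)).
  by split; [|rewrite setIC]; exact: h.
move=> j; apply/smooth_onE => _ [m [am bm] <-] /=.
have [v lv ev] : exists2 v, hlat H v &
    \forall y' \near hsec a m, hsec b (pi y') = hmul H v y'.
  by apply: hsec_near; rewrite hsec_pi.
apply: (@smooth_at_affine _ _ (hlin H v) v).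
by apply: filterS ev => y' e; rewrite /transition /local_rep /= e hmulE.
Qed.

(** Closedness of the lattice in quantitative form: one coordinate keeps a positive distance from
    all multiples of its period. *)
Lemma hlat_closed (v : 'rV[R]_n) : ~ hlat H v ->
  exists i, exists2 e, 0 < e & forall a k, `|v 0 i - a| < e ->
    a <> hper H i * k%:~R.
Proof.
move=> /existsNP[i /forallNP h]; exists i.
have p0 : 0 < hper H i by apply: lt_le_trans (hper_ge1 H i).
pose k := Num.floor (v 0 i / hper H i).
have k1 : hper H i * k%:~R < v 0 i.
  rewrite lt_neqAle; apply/andP; split; first by apply/eqP => e; exact: (h k).
  by rewrite mulrC -ler_pdivlMr// floor_le.
have k2 : v 0 i < hper H i * (k + 1)%:~R.
  by rewrite mulrC -ltr_pdivrMr// floorD1_gt.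
(* The distance to the nearer of the two consecutive multiples that enclose the coordinate. *)
exists (Num.min (v 0 i - hper H i * k%:~R) (hper H i * (k + 1)%:~R - v 0 i)).
  by rewrite lt_min !subr_gt0 k1.
move=> a l; rewrite lt_min !ltr_norml => /andP[/andP[a1 a2] /andP[a3 a4]] ae.
have : hper H i * k%:~R < hper H i * l%:~R by rewrite -ae; lra.
have : hper H i * l%:~R < hper H i * (k + 1)%:~R by rewrite -ae; lra.
by rewrite !ltr_pM2l// !ltr_int; lia.
Qed.

(** Two lifts are equivalent exactly when their quotient [F] lies in the lattice. If [F (x, x')]
    does not, then by [hlat_closed] and continuity neither does [F] at nearby pairs, and the images
    of the two neighbourhoods are disjoint. *)
Lemma hspace_hausdorff : hausdorff_space M.
Proof.
rewrite open_hausdorff => m m' /eqP mm'.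
rewrite -(hrepK m) -(hrepK m') in mm' *.
move: (hrep m) (hrep m') mm' => x x' {m m'} xx'.
pose F (q : 'rV[R]_n * 'rV[R]_n) := q.2 - q.1 - hform H q.2 q.1 *: 'e_(hz H).
have FP q : pi q.1 = pi q.2 -> hlat H (F q).
  by move=> /hpiP[v lv e]; rewrite /F -(hmul_inv_r e).
have nF : ~ hlat H (F (x, x')).
  move=> lF; apply: xx'; apply/hpiP; exists (F (x, x')) => //.
  rewrite /F /= /hmul; rewrite !hformDl !hformNl hformvv hform_zl.
  by apply/rowP => i; rewrite !mxE; ring.
have [i [e e0 h]] := hlat_closed nF.
have cF : {for (x, x'), continuous (fun q => F q 0 i)}.
  have c1 k : {for (x, x'), continuous (fun q : 'rV[R]_n * 'rV[R]_n => q.1 0 k)}.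
    apply: (@continuous_comp _ _ _ fst (fun y : 'rV[R]_n => y 0 k)).
      exact: cvg_fst.
    exact: coord_continuous.
  have c2 k : {for (x, x'), continuous (fun q : 'rV[R]_n * 'rV[R]_n => q.2 0 k)}.
    apply: (@continuous_comp _ _ _ snd (fun y : 'rV[R]_n => y 0 k)).
      exact: cvg_snd.
    exact: coord_continuous.
  have FE : (fun q => F q 0 i) = (fun q => q.2 0 i - q.1 0 i -
      (\sum_k (\sum_l q.2 0 l * hJ H l k) * q.1 0 k) * ('e_(hz H) : 'rV[R]_n) 0 i).
    apply/funext => q; rewrite /F /hform !mxE; congr (_ - _ * _).
    by apply: eq_bigr => k _; rewrite !mxE.
  rewrite FE; apply: cvgB; first by apply: cvgB; [exact: c2|exact: c1].
  apply: cvgM; last exact: cvg_cst.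
  apply: cvg_sumR => k; apply: cvgM; last exact: c1.
  by apply: cvg_sumR => l; apply: cvgM; [exact: c2|exact: cvg_cst].
have : nbhs (F (x, x') 0 i) (ball (F (x, x') 0 i) e) by exact: nbhsx_ballx.
move=> /cF [[A B] /= [nA nB] AB].
exists (pi @` A^°, pi @` B^°); rewrite /=.
  by rewrite !inE; split; [exists x|exists x'].
split; [by apply: hpi_open; exact: open_interior
       |by apply: hpi_open; exact: open_interior|].
apply/eqP/seteqP; split=> // _ [[a Aa <-] [b Bb /esym ab]].
have [k Fk] := FP (a, b) ab i.
have : ball (F (x, x') 0 i) e (F (a, b) 0 i).
  by apply: (AB (a, b)); split=> /=; exact: interior_subset.
by move=> bF; exact: (h _ k bF Fk).
Qed.

(** The non-central coordinates are reduced first; a central translation then adjusts the central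
    one without moving the others. *)
Lemma hpi_box m : exists2 y, pi y = m & forall i, 0 <= y 0 i <= hper H i.
Proof.
pose q i (a : R) : int := - Num.floor (a / hper H i).
have qP i a : 0 <= hper H i * (q i a)%:~R + a <= hper H i.
  have p0 : 0 < hper H i by apply: lt_le_trans (hper_ge1 H i).
  have := floor_itv (a / hper H i); rewrite -/(q i a).
  rewrite ler_pdivlMr// ltr_pdivrMr// rmorphN /= rmorphD /=.
  by move=> /andP[]; nra.
pose x := hrep m.
pose v := \row_i (if i == hz H then 0 else hper H i * (q i (x 0 i))%:~R) : 'rV[R]_n.
have lv : hlat H v.
  move=> i; rewrite !mxE; case: ifP => _; last by exists (q i (x 0 i)).
  by exists 0; rewrite mulr0.
pose a := hper H (hz H) * (q (hz H) (hmul H v x 0 (hz H)))%:~R.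
have lw : hlat H (a *: 'e_(hz H)).
  move=> i; rewrite !mxE eqxx /=; have [->|_] := eqVneq i (hz H).
    by exists (q (hz H) (hmul H v x 0 (hz H))); rewrite mulr1.
  by exists 0; rewrite !mulr0.
exists (hmul H (a *: 'e_(hz H)) (hmul H v x)).
  by rewrite !hpi_mul// hrepK.
have -> : hmul H (a *: 'e_(hz H)) (hmul H v x) = a *: 'e_(hz H) + hmul H v x.
  by rewrite /hmul hform_zl scale0r addr0.
move=> i; have [->|iz] := eqVneq i (hz H).
  rewrite 2!mxE [X in a * X]mxE !eqxx mulr1; exact: qP.
by rewrite /hmul !mxE (negbTE iz) !eqxx /= !mulr0 add0r addr0; exact: qP.
Qed.

Lemma hspace_compact : compact [set: M].
Proof.
have -> : [set: M] = pi @` [set y : 'rV[R]_n | forall i, 0 <= y 0 i <= hper H i].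
  apply/seteqP; split=> // m _; have [y <- yb] := hpi_box m.
  by exists y.
apply: continuous_compact; first exact/continuous_subspaceT/hpi_continuous.
have := @rV_compact R n (fun i => `[0, hper H i]%classic).
move=> cB; have := cB (fun i => @segment_compact _ _ _).
congr compact; apply/seteqP; split=> y /= h i; have := h i; by rewrite /= in_itv.
Qed.

Lemma hspace_second_countable : @second_countable M.
Proof.
pose b (q : 'rV[rat]_n * nat) : set M := pi @` ball (map_mx ratr q.1 :
  'rV[R]_n) q.2.+1%:R^-1.
exists (range b).
  exact: sub_countable (card_image_le _ _) (countableP _).
split; first by move=> _ [q _ <-]; apply: hpi_open; exact: ball_open.
move=> m A; rewrite -(hrepK m); move: (hrep m) => y {m} nA.
have /nbhs_ballP[e /= e0 eA] : nbhs y (pi @^-1` A) by exact: hpi_continuous.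
have [k k0] : exists k : nat, k.+1%:R^-1 < e / 2.
  have /ltr_add_invr[k] : 0 < e / 2 by lra.
  by rewrite add0r; exists k.
pose d : R := k.+1%:R^-1.
have k1 : 0 < d by rewrite invr_gt0.
have ex i : exists r : rat, `|y 0 i - ratr r| < d.
  clearbody d.
  have /rat_in_itvoo[r] : y 0 i < y 0 i + d by lra.
  rewrite in_itv /= => /andP[r1 r2]; exists r.
  by rewrite ltr_norml; apply/andP; split; lra.
have [r rP] := choice ex.
pose q : 'rV[rat]_n := \row_i r i.
exists (b (q, k)); first split; first by exists (q, k).
  exists y => //; apply/ball_rVE => // i.
  by rewrite !mxE distrC.
move=> _ [y' /(ball_rVE _ _ k1) qy' <-]; apply: eA.
apply/(ball_rVE _ _ e0) => i; have := qy' i; rewrite !mxE => a.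
have -> : y 0 i - y' 0 i = (y 0 i - ratr (r i)) + (ratr (r i) - y' 0 i) by ring.
by apply: le_lt_trans (ler_normD _ _) _; have := rP i; rewrite -/d in k0; lra.
Qed.

Lemma hchart_cover (m : M) : exists2 c, range hchart c & cdom c m.
Proof.
exists (hchart (hrep m)); first by exists (hrep m).
by exists (hrep m); [exact: ballxx|exact: hrepK].
Qed.

Lemma range_hchart_compatible c d :
  range hchart c -> range hchart d -> smooth_compatible c d.
Proof. by move=> [x _ <-] [x' _ <-]; exact: hchart_compatible. Qed.

Definition hmfd : manifold R n :=
  Manifold hspace_hausdorff hspace_second_countable hchart_cover
    range_hchart_compatible.

Lemma hmfd_closed : closed_manifold hmfd.
Proof. by split; [exact: hspace_compact|exists (pi 0)]. Qed.

End HeisenbergManifold.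

(** * The invariant frame *)

Section StructureConstants.
Context {R : realType} (j : nat).
Local Notation m := (j + j)%N.

(** Entries are given as lists so that products and transposes reduce by computation, leaving
    sixteen rational identities. *)
Definition mx4 (s : seq (seq R)) : 'M[R]_4 := \matrix_(a, b) nth 0 (nth [::] s a) b.

Definition bd (A : 'M[R]_4) (B : 'M[R]_m) : 'M[R]_(4 + m) := block_mx A 0 0 B.

Lemma bdM A B A' B' : bd A B *m bd A' B' = bd (A *m A') (B *m B').
Proof. by rewrite /bd mulmx_block !mulmx0 !mul0mx !addr0 add0r. Qed.

Lemma bdD A B A' B' : bd A B + bd A' B' = bd (A + A') (B + B').
Proof. by rewrite /bd add_block_mx !addr0. Qed.

Lemma bdN A B : - bd A B = bd (- A) (- B).
Proof. by rewrite /bd opp_block_mx !oppr0. Qed.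

Lemma bdZ a A B : a *: bd A B = bd (a *: A) (a *: B).
Proof. by rewrite /bd scale_block_mx !scaler0. Qed.

Lemma bdT A B : (bd A B)^T = bd A^T B^T.
Proof. by rewrite /bd tr_block_mx !trmx0. Qed.

Lemma bd1 a : a%:M = bd a%:M a%:M.
Proof. exact: scalar_mx_block. Qed.

Definition bdE := (bdT, bdM, bdN, bdZ, bdD).

Definition rotJ : 'M[R]_m := block_mx 0 1%:M (- 1%:M) 0.

Definition J4 := mx4
  [:: [:: 0; 0; 0; 0]; [:: 0; 0; 0; 0]; [:: 0; 0; 0; 1]; [:: 0; 0; -1; 0]].
Definition L4 := mx4
  [:: [:: 0; 0; 0; 0]; [:: 0; 0; 0; 0]; [:: 0; 0; 0; -1]; [:: 0; -1; 1; 0]].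
Definition P4 := mx4
  [:: [:: 1; 0; 0; 0]; [:: 1; 1; 0; 0]; [:: 0; -1; 1; 0]; [:: 0; 0; 0; 1]].
Definition Pi4 := mx4
  [:: [:: 1; 0; 0; 0]; [:: -1; 1; 0; 0]; [:: -1; 1; 1; 0]; [:: 0; 0; 0; 1]].
Definition M4 := mx4
  [:: [:: 0; 0; 0; 0]; [:: 0; 0; 0; - 2^-1]; [:: 0; 0; 0; -1];
      [:: 0; - 2^-1; 1; 0]].
Definition K4 := mx4
  [:: [:: 0; 0; 0; 0]; [:: 0; 4^-1; 0; 0]; [:: 0; 0; 1; 0]; [:: 0; 0; 0; 4^-1]].

(* The coordinates are t, s, x, y, r' in this order.  With u = e^(-it) w,
   [rot_gen], [gram0], [covT0] and [jacobi0] are the matrices of the Lie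
   derivative along T, of g, of U |-> nabla_U T and of R_T in the coframe
   theta, z - Re u, Re u, Im u, dr'; at t = 0 this coframe is [cof0] times
   dt, z, dx, dy, dr'. *)
Definition symJ := locked (bd J4 rotJ).
Definition rot_gen := locked (bd L4 0).
Definition cof0 := locked (bd P4 1%:M).
Definition cof0_inv := locked (bd Pi4 1%:M).
Definition gram0 := locked (bd 1%:M 2%:M).
Definition covT0 := locked (bd M4 (- 2^-1 *: rotJ)).
Definition jacobi0 := locked (bd K4 (4^-1)%:M).

Lemma mx4M s t : mx4 s *m mx4 t = mx4
  [seq [seq nth 0 (nth [::] s a) 0 * nth 0 (nth [::] t 0) b
       + nth 0 (nth [::] s a) 1 * nth 0 (nth [::] t 1) b
       + nth 0 (nth [::] s a) 2 * nth 0 (nth [::] t 2) b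
       + nth 0 (nth [::] s a) 3 * nth 0 (nth [::] t 3) b
       | b <- iota 0 4] | a <- iota 0 4].
Proof.
apply/matrixP => a b; rewrite !mxE !big_ord_recl big_ord0 !mxE addr0 !addrA.
by rewrite (nth_map 0%N) ?size_iota// (nth_map 0%N) ?size_iota// !nth_iota.
Qed.

Lemma mx4T s : (mx4 s)^T = mx4
  [seq [seq nth 0 (nth [::] s b) a | b <- iota 0 4] | a <- iota 0 4].
Proof.
apply/matrixP => a b; rewrite !mxE.
by rewrite (nth_map 0%N) ?size_iota// (nth_map 0%N) ?size_iota// !nth_iota.
Qed.

Ltac mx4_tac :=
  rewrite ?(mx4M, mx4T) /=;
  apply/matrixP => -[[|[|[|[|//]]]] ?] -[[|[|[|[|//]]]] ?];
  rewrite !mxE /=; lra.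

Lemma rotJ_tr : rotJ^T = - rotJ.
Proof. by rewrite /rotJ tr_block_mx opp_block_mx !linearN /= !trmx0 !trmx1
  !oppr0 opprK. Qed.

Lemma rotJ2 : rotJ *m rotJ = - 1%:M.
Proof.
rewrite /rotJ mulmx_block !mulmx0 !mul0mx !mulmx1 !mul1mx !addr0 !add0r.
by rewrite (scalar_mx_block j j 1) opp_block_mx oppr0.
Qed.

Lemma symJ_antisym : symJ^T = - symJ.
Proof. by rewrite /symJ -!lock !bdE rotJ_tr; congr bd; mx4_tac. Qed.

Lemma rot_gen3 : rot_gen *m rot_gen *m rot_gen = - rot_gen.
Proof. by rewrite /rot_gen -!lock !bdE !mul0mx oppr0; congr bd; mx4_tac. Qed.

(** Infinitesimal form of the invariance of dx ^ dy under rotation of w. *)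
Lemma rot_gen_symJ : rot_gen *m symJ = - (symJ *m rot_gen^T).
Proof. by rewrite /rot_gen /symJ -!lock !bdE mul0mx trmx0 mulmx0 oppr0;
  congr bd; mx4_tac. Qed.

Lemma cof0_symJ : cof0 *m symJ = symJ.
Proof. by rewrite /cof0 /symJ -!lock !bdE mul1mx; congr bd; mx4_tac. Qed.

Lemma cof0V : cof0 *m cof0_inv = 1%:M.
Proof. by rewrite /cof0 /cof0_inv -!lock !bdE mul1mx bd1; congr bd; mx4_tac. Qed.

(** The Koszul formula 2 g(nabla_U T, V) = (L_T g)(U, V) + d theta(U, V) in the coframe, where d
    theta = - 2 J. *)
Lemma covT0_gram0 : covT0 *m gram0 =
  2^-1 *: (rot_gen *m gram0 + gram0 *m rot_gen^T) - symJ.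
Proof.
rewrite /covT0 /gram0 /rot_gen /symJ -!lock !bdE !mulmx1 !mul1mx !trmx0 mul0mx
  mulmx0 addr0 scaler0.
congr bd; first by mx4_tac.
by rewrite mul_mx_scalar scalerA mulrN mulfV ?scaleN1r ?add0r// pnatr_eq0.
Qed.

(** The Riccati equation C' + C^2 = - R_T for C = nabla T, the t-derivative being the commutator
    with L. On the r' block a weight c in front of |dr'|^2 gives C = - J / c and curvature 1 / c^2,
    so the eigenvalue 1/4 dictates the weight 2. *)
Lemma jacobi0E : rot_gen *m covT0 - covT0 *m rot_gen + covT0 *m covT0 = - jacobi0.
Proof.
rewrite /covT0 /jacobi0 /rot_gen -!lock !bdE mul0mx mulmx0 oppr0 !add0r.
congr bd; first by mx4_tac.
rewrite -scalemxAl -scalemxAr scalerA rotJ2 scalerN scalemx1.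
by congr (- (_%:M)); lra.
Qed.

(** [covT0 - rot_gen] is the connection matrix of nabla_T on components in the moving frame, so this
    commutation is the parallelism of R_T. *)
Lemma jacobi0_comm : (rot_gen - covT0) *m jacobi0 = jacobi0 *m (rot_gen - covT0).
Proof.
rewrite mulmxBl mulmxBr /covT0 /jacobi0 /rot_gen -!lock !bdE; congr bd;
  first by mx4_tac.
by rewrite mul0mx mulmx0 mul_mx_scalar mul_scalar_mx.
Qed.

Lemma gram0_tr : gram0^T = gram0.
Proof. by rewrite /gram0 -!lock bdT !tr_scalar_mx. Qed.

(** The positions of t, s, x among the coordinates, and of theta, z - Re u, Re u in the coframe. *)
Definition i0 : 'I_(4 + m) := lshift m (@Ordinal 4 0 isT).
Definition i1 : 'I_(4 + m) := lshift m (@Ordinal 4 1 isT).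
Definition i2 : 'I_(4 + m) := lshift m (@Ordinal 4 2 isT).

Lemma e_lshift (a : 'I_4) : 'e_(lshift m a) = row_mx 'e_a 0 :> 'rV[R]_(4 + m).
Proof.
apply/rowP => b; rewrite !mxE eqxx /=; case: splitP => c bc; rewrite !mxE ?eqxx /=.
  by rewrite -!val_eqE /= bc.
by rewrite -val_eqE /= bc eqn_leq leqNgt (leq_trans (ltn_ord a)) ?leq_addr.
Qed.

Lemma e_bd (a : 'I_4) A B :
  (delta_mx 0 (lshift m a) : 'rV[R]_(4 + m)) *m bd A B = row_mx (row a A) 0.
Proof. by rewrite e_lshift /bd mul_row_block !mulmx0 !mul0mx !addr0 -rowE. Qed.

Lemma bd_e (a : 'I_4) A B :
  bd A B *m (delta_mx 0 (lshift m a) : 'rV[R]_(4 + m))^T = col_mx (col a A) 0.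
Proof.
rewrite e_lshift tr_row_mx /bd mul_block_col trmx0 !mulmx0 !mul0mx !addr0.
by rewrite trmx_delta -colE.
Qed.

Ltac row4_tac :=
  apply/rowP => -[[|[|[|[|//]]]] ?]; rewrite !mxE /=; lra.

Ltac col4_tac :=
  apply/colP => -[[|[|[|[|//]]]] ?]; rewrite !mxE /=; lra.

Lemma e0_rot_gen : (delta_mx 0 i0 : 'rV[R]_(4 + m)) *m rot_gen = 0.
Proof. by rewrite /rot_gen -lock e_bd -[RHS]row_mx0; congr row_mx; row4_tac. Qed.

Lemma rot_gen_e0 : rot_gen *m (delta_mx 0 i0 : 'rV[R]_(4 + m))^T = 0.
Proof. by rewrite /rot_gen -lock bd_e -[RHS]col_mx0; congr col_mx; col4_tac. Qed.

Lemma e0_cof0 : (delta_mx 0 i0 : 'rV[R]_(4 + m)) *m cof0 = 'e_i0.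
Proof. by rewrite /cof0 -lock e_bd e_lshift; congr row_mx; row4_tac. Qed.

Lemma cof0_e0 : cof0 *m (delta_mx 0 i0 : 'rV[R]_(4 + m))^T = ('e_i0 + 'e_i1)^T.
Proof.
rewrite /cof0 -lock bd_e !e_lshift add_row_mx tr_row_mx addr0 trmx0; congr col_mx.
by col4_tac.
Qed.

Lemma e0_gram0 : (delta_mx 0 i0 : 'rV[R]_(4 + m)) *m gram0 = 'e_i0.
Proof. by rewrite /gram0 -lock e_bd e_lshift; congr row_mx; row4_tac. Qed.

Lemma e0_jacobi0 : (delta_mx 0 i0 : 'rV[R]_(4 + m)) *m jacobi0 = 0.
Proof. by rewrite /jacobi0 -lock e_bd -[RHS]row_mx0; congr row_mx; row4_tac. Qed.

Lemma jacobi0_e0 : jacobi0 *m (delta_mx 0 i0 : 'rV[R]_(4 + m))^T = 0.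
Proof. by rewrite /jacobi0 -lock bd_e -[RHS]col_mx0; congr col_mx; col4_tac. Qed.

Lemma e0_covT0 : (delta_mx 0 i0 : 'rV[R]_(4 + m)) *m covT0 = 0.
Proof. by rewrite /covT0 -lock e_bd -[RHS]row_mx0; congr row_mx; row4_tac. Qed.

Lemma symJ_0 i : symJ i0 i = 0.
Proof.
have -> : symJ i0 i = ((delta_mx 0 i0 : 'rV[R]_(4 + m)) *m symJ) 0 i by rewrite
  -rowE [RHS]mxE.
rewrite /symJ -lock e_bd (_ : row _ _ = 0) ?row_mx0 ?mxE//.
by row4_tac.
Qed.

Lemma symJ_1 i : symJ i1 i = 0.
Proof.
have -> : symJ i1 i = ((delta_mx 0 i1 : 'rV[R]_(4 + m)) *m symJ) 0 i by rewrite
  -rowE [RHS]mxE.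
rewrite /symJ -lock e_bd (_ : row _ _ = 0) ?row_mx0 ?mxE//.
by row4_tac.
Qed.

Lemma symJ_int a b : symJ a b \is a Num.int.
Proof.
rewrite /symJ -!lock !mxE; case: splitP => c _; rewrite !mxE;
  case: splitP => d _; rewrite !mxE //.
  move: c d => -[[|[|[|[|//]]]] ?] -[[|[|[|[|//]]]] ?] /=;
    by rewrite ?rpredN ?rpred0 ?rpred1.
case: splitP => ? _; rewrite !mxE; case: splitP => ? _; rewrite !mxE //.
by rewrite rpredN rpred_nat.
Qed.

Definition dcoef (a : nat) : R := if (a < 4)%N then 1 else 2.

(** Index 0 is theta, where R_T vanishes, and index 2 is Re u, the component of frequency 1. *)
Definition kcoef (a : nat) : R :=
  if a == 0%N then 0 else if a == 2 then 1 else 4^-1.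

Lemma gram0_diag : gram0 = diag_mx (\row_a dcoef a).
Proof.
apply/matrixP => a b; rewrite /gram0 -!lock /bd /dcoef.
case: (split_ordP a) => c ->; case: (split_ordP b) => d ->.
- by rewrite block_mxEul !mxE /= ltn_ord.
- by rewrite block_mxEur !mxE /= eq_lrshift.
- by rewrite block_mxEdl !mxE /= eq_rlshift.
- by rewrite block_mxEdr !mxE /= eq_rshift.
Qed.

Lemma jacobi0_diag : jacobi0 = diag_mx (\row_a kcoef a).
Proof.
apply/matrixP => a b; rewrite /jacobi0 -!lock /bd /kcoef.
case: (split_ordP a) => c ->; case: (split_ordP b) => d ->.
- rewrite block_mxEul !mxE (inj_eq (@lshift_inj _ _)) /=.
  by move: c d => -[[|[|[|[|//]]]] ?] -[[|[|[|[|//]]]] ?].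
- by rewrite block_mxEur !mxE /= eq_lrshift.
- by rewrite block_mxEdl !mxE /= eq_rlshift.
- by rewrite block_mxEdr !mxE /= eq_rshift.
Qed.

Lemma diag_form n (d w : 'rV[R]_n) :
  ip (diag_mx d) w w = \sum_a d 0 a * (w 0 a) ^+ 2.
Proof.
rewrite /ip mul_mx_diag mxE; apply: eq_bigr => a _.
by rewrite !mxE expr2 mulrAC mulrC.
Qed.

Lemma diag_form_gt0 n (d w : 'rV[R]_n) : w != 0 -> (forall a, 0 <= d 0 a) ->
  (forall a, d 0 a = 0 -> w 0 a = 0) -> 0 < ip (diag_mx d) w w.
Proof.
move=> /rV0Pn[a wa] d0 dw; rewrite diag_form (bigD1 a)//=; apply: ltr_wpDr.
  by apply: sumr_ge0 => b _; exact: mulr_ge0 (sqr_ge0 _).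
apply: mulr_gt0; last by rewrite lt_def sqrf_eq0 wa sqr_ge0.
by rewrite lt_def d0 andbT; apply: contraNneq wa => /dw ->.
Qed.

Lemma gram0_form_gt0 (w : 'rV[R]_(4 + m)) : w != 0 -> 0 < ip gram0 w w.
Proof.
move=> w0; rewrite gram0_diag; apply: diag_form_gt0 => // a; rewrite mxE /dcoef.
  by case: ifP.
by case: ifP => _ /eqP; rewrite ?oner_eq0 ?pnatr_eq0.
Qed.

Lemma jacobi0_form_gt0 (w : 'rV[R]_(4 + m)) : w != 0 -> w 0 i0 = 0 ->
  0 < ip (jacobi0 *m gram0) w w.
Proof.
move=> w0 w00; rewrite jacobi0_diag gram0_diag mulmx_diag.
apply: diag_form_gt0 => // a; rewrite !mxE /kcoef /dcoef.
  by apply: mulr_ge0; do 2?case: ifP => //; rewrite ?invr_ge0.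
have [a0 _|_] := eqVneq (nat_of_ord a) 0%N.
  by rewrite -w00; congr (w 0 _); apply: val_inj.
move/eqP; rewrite mulf_eq0; case: ifP => _; case: ifP => _;
  by rewrite ?invr_eq0 ?oner_eq0 ?pnatr_eq0.
Qed.

Lemma jacobi0_eigen (w : 'rV[R]_(4 + m)) a :
  w *m jacobi0 = a *: w <-> forall b, w 0 b = 0 \/ kcoef b = a.
Proof.
rewrite jacobi0_diag mul_mx_diag; split=> [/rowP h b|h]; last first.
  apply/rowP => b; rewrite !mxE; have [->|->] := h b; last by rewrite mulrC.
  by rewrite mul0r mulr0.
have := h b; rewrite !mxE mulrC => /eqP; rewrite -subr_eq0 -mulrBl mulf_eq0.
by move=> /orP[]/eqP ?; [right; apply: subr0_eq|left].
Qed.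

End StructureConstants.

(** * Partial derivatives of matrix-valued functions *)

Section MatrixCalculus.
Context {R : realType} {n : nat}.

Definition pmx p q (k : 'I_n) (F : 'rV[R]_n -> 'M[R]_(p, q)) (y : 'rV[R]_n) :
  'M[R]_(p, q) := \matrix_(a, b) partial k (fun z => F z a b) y.

Definition derivable_mx p q (k : 'I_n) (F : 'rV[R]_n -> 'M[R]_(p, q)) y : Prop :=
  forall a b, derivable (fun z => F z a b) y 'e_k.

Definition trigpoly_mx p q (F : 'rV[R]_n -> 'M[R]_(p, q)) : Prop :=
  forall a b, trigpoly (fun z => F z a b).

Lemma trigpoly_mx_cst p q (A : 'M[R]_(p, q)) : trigpoly_mx (fun=> A).
Proof. by move=> a b; exact: tp_cst. Qed.

Lemma trigpoly_mxM p q r (F : 'rV[R]_n -> 'M[R]_(p, q)) (E : 'rV[R]_n ->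
  'M[R]_(q, r)) :
  trigpoly_mx F -> trigpoly_mx E -> trigpoly_mx (fun y => F y *m E y).
Proof.
move=> tF tE a b; under eq_fun do rewrite mxE.
by apply: trigpoly_sum => k; exact: tp_mul.
Qed.

Lemma trigpoly_mxD p q (F E : 'rV[R]_n -> 'M[R]_(p, q)) :
  trigpoly_mx F -> trigpoly_mx E -> trigpoly_mx (fun y => F y + E y).
Proof. by move=> tF tE a b; under eq_fun do rewrite mxE; exact: tp_add. Qed.

Lemma trigpoly_mxZ p q f (F : 'rV[R]_n -> 'M[R]_(p, q)) :
  trigpoly f -> trigpoly_mx F -> trigpoly_mx (fun y => f y *: F y).
Proof. by move=> tf tF a b; under eq_fun do rewrite mxE; exact: tp_mul. Qed.

Lemma trigpoly_mxT p q (F : 'rV[R]_n -> 'M[R]_(p, q)) :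
  trigpoly_mx F -> trigpoly_mx (fun y => (F y)^T).
Proof. by move=> tF a b; under eq_fun do rewrite mxE; exact: tF. Qed.

Lemma trigpoly_derivable_mx p q k (F : 'rV[R]_n -> 'M[R]_(p, q)) y :
  trigpoly_mx F -> derivable_mx k F y.
Proof. by move=> tF a b; exact: trigpoly_derivable. Qed.

Lemma derivable_mxM p q r k (F : 'rV[R]_n -> 'M[R]_(p, q))
    (E : 'rV[R]_n -> 'M[R]_(q, r)) y :
  derivable_mx k F y -> derivable_mx k E y ->
  derivable_mx k (fun y => F y *m E y) y /\
  pmx k (fun y => F y *m E y) y = pmx k F y *m E y + F y *m pmx k E y.
Proof.
move=> dF dE.
have dFE a b c : derivable (fun z => F z a c * E z c b) y 'e_k by exact: derivableM.
split=> [a b|].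
  under eq_fun do rewrite mxE.
  by have [] := partial_sum (index_enum 'I_q) (dFE a b).
apply/matrixP => a b; rewrite !mxE; under eq_fun do rewrite mxE.
have [_ ->] := partial_sum (index_enum 'I_q) (dFE a b).
rewrite -big_split /=; apply: eq_bigr => c _.
by rewrite (partialM (dF a c) (dE c b)) !mxE; ring.
Qed.

Lemma pmx_cst p q k (A : 'M[R]_(p, q)) y : pmx k (fun=> A) y = 0.
Proof. by apply/matrixP => a b; rewrite !mxE partial_cst. Qed.

Lemma pmxM_cst p q r k (F : 'rV[R]_n -> 'M[R]_(p, q)) (A : 'M[R]_(q, r)) y :
  derivable_mx k F y -> pmx k (fun y => F y *m A) y = pmx k F y *m A.
Proof.
move=> dF; have dA : derivable_mx k (fun=> A) y by move=> a b; exact: derivable_cst.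
by have [_ ->] := derivable_mxM dF dA; rewrite pmx_cst mulmx0 addr0.
Qed.

Lemma pmxT p q k (F : 'rV[R]_n -> 'M[R]_(p, q)) y :
  pmx k (fun y => (F y)^T) y = (pmx k F y)^T.
Proof. by apply/matrixP => a b; rewrite !mxE; under eq_fun do rewrite mxE. Qed.

Lemma near_pmx p q k (F E : 'rV[R]_n -> 'M[R]_(p, q)) (y : 'rV[R]_n) :
  {near y, F =1 E} -> pmx k F y = pmx k E y.
Proof.
move=> FE; apply/matrixP => a b; rewrite !mxE.
by apply: (nbhs_singleton (near_partial k _)); apply: filterS FE => z ->.
Qed.

End MatrixCalculus.

(** * The rotating left-invariant coframe and its metric *)

Section ModelMetric.
Context {R : realType} (j : nat).
Local Notation m := (j + j)%N.
Local Notation N := (4 + m)%N.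
Local Notation J := (@symJ R j).
Local Notation i0 := (i0 j).
Local Notation i1 := (i1 j).
Local Notation L := (@rot_gen R j).
Local Notation e0 := (delta_mx 0 i0 : 'rV[R]_N).

(** The t-period is that of the rotation. It may be irrational because J pairs t with nothing
    ([symJ_0]), so the cocycle takes integer values on the lattice all the same. *)
Definition mper (a : 'I_N) : R := if a == i0 then trigo.pi *+ 2 else 1.

Lemma mper_ge1 a : 1 <= mper a.
Proof.
by rewrite /mper; case: ifP => // _; have := pi_ge2 R; rewrite mulr2n; lra.
Qed.

Lemma symJ_lattice (v w : 'rV[R]_N) :
  (forall a, exists k : int, v 0 a = mper a * k%:~R) ->
  (forall a, exists k : int, w 0 a = mper a * k%:~R) ->
  exists k : int, (v *m J *m w^T) 0 0 = mper i1 * k%:~R.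
Proof.
move=> lv lw; suff /intrP[k kE] : (v *m J *m w^T) 0 0 \is a Num.int.
  by exists k; rewrite kE (_ : mper i1 = 1) ?mul1r.
have int_coord u a : (forall a, exists k : int, u 0 a = mper a * k%:~R) ->
    a != i0 -> u 0 a \is a Num.int.
  by move=> lu a0; have [k ->] := lu a; rewrite /mper ifN// mul1r intr_int.
have J0r a : J a i0 = 0.
  by have /matrixP/(_ a i0) := @symJ_antisym R j;
    rewrite [LHS]mxE [RHS]mxE symJ_0 => ?; lra.
rewrite mxE; apply: rpred_sum => b _; rewrite !mxE mulr_suml.
apply: rpred_sum => a _.
have [->|a0] := eqVneq a i0; first by rewrite symJ_0 mulr0 mul0r rpred0.
have [->|b0] := eqVneq b i0; first by rewrite J0r mulr0 mul0r rpred0.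
by rewrite rpredM ?rpredM ?symJ_int ?int_coord.
Qed.

Definition nil_heis : heis R N :=
  Heis (@symJ_antisym R j) (@symJ_1 R j) mper_ge1 symJ_lattice.

(* exp (t L), since L^3 = - L. *)
Definition rot (t : R) : 'M[R]_N := 1%:M + sin t *: L + (1 - cos t) *: (L *m L).

Lemma rot_gen_pow : [/\ L *m (L *m L) = - L, (L *m L) *m L = - L
  & (L *m L) *m (L *m L) = - (L *m L)].
Proof. by split; rewrite ?mulmxA rot_gen3 // mulNmx. Qed.

Lemma versin_sq (t : R) : sin t ^+ 2 = 2 * (1 - cos t) - (1 - cos t) ^+ 2.
Proof. by rewrite sin2cos2; ring. Qed.

Lemma rotNr t : rot t *m rot (- t) = 1%:M.
Proof.
have [LA AL AA] := rot_gen_pow.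
rewrite /rot sinN cosN !mulmxDl !mulmxDr !mul1mx !mulmx1 -!scalemxAl -!scalemxAr.
rewrite !scalerA LA AL AA; have := versin_sq t.
set A := L *m L; set s := sin t; set c := 1 - cos t => sc.
apply/matrixP => a b; rewrite !mxE; rewrite expr2 in sc.
by rewrite mulrN sc; ring.
Qed.

Lemma rot_e0 t : rot t *m e0^T = e0^T.
Proof.
by rewrite /rot !mulmxDl mul1mx -!scalemxAl -mulmxA rot_gen_e0 mulmx0 !scaler0
  !addr0.
Qed.

Lemma e0_rot t : e0 *m rot t = e0.
Proof.
by rewrite /rot !mulmxDr mulmx1 -!scalemxAr mulmxA e0_rot_gen mul0mx !scaler0
  !addr0.
Qed.

Lemma rot_symJ t : rot t *m J *m (rot t)^T = J.
Proof.
have JL : J *m L^T = - (L *m J) by rewrite rot_gen_symJ opprK.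
(* The commutation of J with the generator, integrated: moving J across [rot] reverses the time. *)
have e : J *m (rot t)^T = rot (- t) *m J.
  have -> : (rot t)^T = 1%:M + sin t *: L^T + (1 - cos t) *: (L^T *m L^T).
    by rewrite /rot !linearD /= !linearZ /= trmx1 trmx_mul.
  rewrite /rot sinN cosN !mulmxDr !mulmxDl.
  have JLL : J *m (L^T *m L^T) = L *m L *m J.
    by rewrite mulmxA JL mulNmx -[in LHS]mulmxA JL mulmxN opprK mulmxA.
  by rewrite mulmx1 mul1mx -!scalemxAr -!scalemxAl JLL JL scalerN scaleNr.
by rewrite -mulmxA e mulmxA rotNr mul1mx.
Qed.

Lemma trigpoly_rot : trigpoly_mx (fun y : 'rV[R]_N => rot (y 0 i0)).
Proof.
apply: trigpoly_mxD; last first.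
  apply: trigpoly_mxZ (trigpoly_mx_cst _); apply: trigpolyB (tp_cst _ _) (tp_cos _).
apply: trigpoly_mxD (trigpoly_mx_cst _) _.
exact: trigpoly_mxZ (tp_sin _) (trigpoly_mx_cst _).
Qed.

Lemma pmx_rot y : pmx i0 (fun y : 'rV[R]_N => rot (y 0 i0)) y = rot (y 0 i0) *m L.
Proof.
have [LA AL AA] := rot_gen_pow.
rewrite /rot !mulmxDl mul1mx -!scalemxAl AL; move: (L *m L) AL => A AL.
apply/matrixP => a b; rewrite mxE /partial.
under eq_fun do rewrite !mxE.
have dsin : derivable (fun z : 'rV[R]_N => sin (z 0 i0)) y 'e_i0.
  exact/trigpoly_derivable/tp_sin.
have dcos : derivable (fun z : 'rV[R]_N => cos (z 0 i0)) y 'e_i0.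
  exact/trigpoly_derivable/tp_cos.
have dcst c : derivable (fun z : 'rV[R]_N => c : R) y 'e_i0.
  exact/trigpoly_derivable/tp_cst.
have d1cos : derivable (fun z : 'rV[R]_N => 1 - cos (z 0 i0)) y 'e_i0.
  exact: derivableB (dcst 1) dcos.
rewrite -[LHS]/(partial i0 _ y).
rewrite (partialD (derivableD (dcst _) (derivableM dsin (dcst _)))
  (derivableM d1cos (dcst _))).
rewrite (partialD (dcst _) (derivableM dsin (dcst _))).
rewrite (partialM dsin (dcst _)) (partialM d1cos (dcst _)) !partial_cst.
have -> : partial i0 (fun z : 'rV[R]_N => 1 - cos (z 0 i0)) y = sin (y 0 i0).
  rewrite /partial (deriveB (dcst 1) dcos) -![derive _ _ _]/(partial i0 _ y).
  by rewrite partial_cst partial_cos eqxx mulr1 opprK add0r.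
by rewrite partial_sin eqxx !mxE /= mulr1n; ring.
Qed.

Local Notation U := (hlin nil_heis).

Lemma hlin_def v : U v = 1%:M + (v *m J)^T *m 'e_i1.
Proof. by []. Qed.

Lemma hlinE v a b :
  U v a b = (a == b)%:R + (\sum_k v 0 k * J k a) * (b == i1)%:R.
Proof.
rewrite hlin_def [LHS]mxE [X in X + _]mxE [X in _ + X]mxE big_ord1.
rewrite [X in X * _]mxE [X in _ * X]mxE eqxx.
by congr (_ + _ * _); rewrite mxE.
Qed.

Lemma e0_J : e0 *m J = 0.
Proof. by rewrite -rowE; apply/rowP => a; rewrite [LHS]mxE symJ_0 mxE. Qed.

Lemma e1_J : 'e_i1 *m J = 0 :> 'rV[R]_N.
Proof. by rewrite -rowE; apply/rowP => a; rewrite [LHS]mxE symJ_1 mxE. Qed.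

Lemma e0_trJ (v : 'rV[R]_N) : e0 *m (v *m J)^T = 0.
Proof. by rewrite trmx_mul mulmxA symJ_antisym mulmxN e0_J oppr0 mul0mx. Qed.

Lemma e1_trJ (v : 'rV[R]_N) : ('e_i1 : 'rV[R]_N) *m (v *m J)^T = 0.
Proof. by rewrite trmx_mul mulmxA symJ_antisym mulmxN e1_J oppr0 mul0mx. Qed.

(** The product of the two corrections vanishes because the centre lies in the kernel of J; in
    particular [U (- y)] inverts [U y]. *)
Lemma hlinD v w : U v *m U w = U (v + w).
Proof.
rewrite !hlin_def mulmxDl mul1mx mulmxDr mulmx1.
rewrite -[X in _ + (_ + X)]mulmxA [X in _ + (_ + _ *m X)]mulmxA e1_trJ.
rewrite mul0mx mulmx0 addr0 mulmxDl [in RHS]linearD [in RHS]mulmxDl.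
by rewrite -addrA; congr (_ + _); rewrite addrC.
Qed.

Lemma hlin0 : U 0 = 1%:M.
Proof. by rewrite hlin_def mul0mx trmx0 mul0mx addr0. Qed.

Lemma hlin_symJ v : U v *m J = J.
Proof. by rewrite hlin_def mulmxDl mul1mx -mulmxA e1_J mulmx0 addr0. Qed.

Lemma e0_hlin v : e0 *m U v = e0.
Proof. by rewrite hlin_def mulmxDr mulmx1 mulmxA e0_trJ mul0mx addr0. Qed.

(* The columns of [Phi y] are the forms of the coframe. *)
Definition Phi (y : 'rV[R]_N) : 'M[R]_N := locked (U (- y) *m cof0 j *m rot (y
  0 i0)).
Definition Psi (y : 'rV[R]_N) : 'M[R]_N := locked (rot (- y 0 i0) *m cof0_inv j
  *m U y).

Lemma PhiPsi y : Phi y *m Psi y = 1%:M.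
Proof.
rewrite /Phi /Psi -!lock !mulmxA -(mulmxA _ _ (rot (- _))) rotNr mulmx1.
by rewrite -(mulmxA _ (cof0 _)) cof0V mulmx1 hlinD addNr hlin0.
Qed.

Lemma PsiPhi y : Psi y *m Phi y = 1%:M.
Proof. exact/mulmx1C/PhiPsi. Qed.

(** The 2-form - d theta / 2 has the same constant matrix J in the coordinates and in the coframe,
    since rotating w preserves dx ^ dy. *)
Lemma Phi_symJ y : Phi y *m J *m (Phi y)^T = J.
Proof.
rewrite /Phi -!lock !trmx_mul !mulmxA -(mulmxA _ (rot _) J) -(mulmxA _ (rot _
  *m _)).
rewrite rot_symJ -(mulmxA _ (cof0 _) J) cof0_symJ hlin_symJ.
have JT A : A *m J = J -> J *m A^T = J.
  by move=> /(congr1 trmx); rewrite trmx_mul symJ_antisym mulNmx => /oppr_inj.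
by rewrite (JT _ (cof0_symJ j)) (JT _ (hlin_symJ _)).
Qed.

Lemma e0_Phi y : e0 *m Phi y = e0.
Proof. by rewrite /Phi -!lock !mulmxA e0_hlin e0_cof0 e0_rot. Qed.

(** The column of theta = dt + ds - r J dr^T. Its entries are affine in y, which makes the
    derivatives of g(T, .) constant. *)
Lemma Phi_e0 y : Phi y *m e0^T = (e0 + 'e_i1 - y *m J)^T.
Proof.
rewrite /Phi -!lock -mulmxA rot_e0 -mulmxA cof0_e0 hlin_def mulmxDl mul1mx -mulmxA.
have -> : ('e_i1 *m (e0 + 'e_i1)^T) = 1%:M :> 'M[R]_1.
  rewrite linearD /= mulmxDr !trmx_delta mul_delta_mx mul_delta_mx_0 ?add0r//.
  by apply/matrixP => a b; rewrite !ord1 !mxE.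
by rewrite mulmx1 -linearD /= mulNmx.
Qed.

Lemma trigpoly_hlin : trigpoly_mx U.
Proof.
move=> a b; under eq_fun do rewrite hlinE.
apply: tp_add (tp_cst _ _) (tp_mul _ (tp_cst _ _)).
by apply: trigpoly_sum => k; exact: tp_mul (tp_coord _) (tp_cst _ _).
Qed.

Lemma hlin_opp v : U (- v) = 2%:M - U v.
Proof.
apply/matrixP => a b; rewrite [RHS]mxE [X in _ + X]mxE !hlinE.
have -> : \sum_k (- v) 0 k * J k a = - \sum_k v 0 k * J k a.
  by rewrite -sumrN; apply: eq_bigr => k _; rewrite mxE mulNr.
by rewrite mxE; case: (a == b); rewrite /= ?mulr1n ?mulr0n; ring.
Qed.

Lemma trigpoly_hlinN : trigpoly_mx (fun y => U (- y)).
Proof.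
under eq_fun do rewrite hlin_opp.
move=> a b; under eq_fun do rewrite mxE [X in _ + X]mxE.
by apply: trigpolyB (tp_cst _ _) _; exact: trigpoly_hlin.
Qed.

Lemma pmx_hlin y : pmx i0 U y = 0.
Proof.
apply/matrixP => a b; rewrite !mxE; under eq_fun do rewrite hlinE.
have dcst c : derivable (fun z : 'rV[R]_N => c : R) y 'e_i0.
  exact/trigpoly_derivable/tp_cst.
have dk k : derivable (fun z : 'rV[R]_N => z 0 k * J k a) y 'e_i0.
  exact/trigpoly_derivable/tp_mul/tp_cst/tp_coord.
have [ds es] := partial_sum (index_enum 'I_N) dk.
rewrite (partialD (dcst _) (derivableM ds (dcst _))) (partialM ds (dcst _)).
suff es0 : \sum_k partial i0 (fun z : 'rV[R]_N => z 0 k * J k a) y = 0.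
  by rewrite !partial_cst es es0 !mulr0 !addr0.
apply: big1 => k _.
have dz : derivable (fun z : 'rV[R]_N => z 0 k) y 'e_i0.
  exact/trigpoly_derivable/tp_coord.
rewrite (partialM dz (dcst _)) partial_cst partial_coord mulr0 add0r.
by case: eqP => [<-|]; rewrite ?symJ_0 ?mul0r ?mulr0.
Qed.

Lemma pmx_hlinN y : pmx i0 (fun z => U (- z)) y = 0.
Proof.
have := pmx_hlin y => /matrixP h; apply/matrixP => a b; have := h a b.
rewrite !mxE /partial => hab; under eq_fun do rewrite hlin_opp mxE [X in _ + X]mxE.
have dcst c : derivable (fun z : 'rV[R]_N => c : R) y 'e_i0.
  exact/trigpoly_derivable/tp_cst.
have dU : derivable (fun z => U z a b) y 'e_i0.
  exact/trigpoly_derivable/trigpoly_hlin.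
by rewrite (deriveB (dcst _) dU) derive_cst hab subr0.
Qed.

Lemma trigpoly_Phi : trigpoly_mx Phi.
Proof.
rewrite /Phi; under eq_fun do rewrite -lock; apply: trigpoly_mxM trigpoly_rot.
exact: trigpoly_mxM trigpoly_hlinN (trigpoly_mx_cst _).
Qed.

Lemma pmx_Phi y : pmx i0 Phi y = Phi y *m L.
Proof.
have d1 := trigpoly_derivable_mx (k := i0) (y := y) trigpoly_hlinN.
have tUP : trigpoly_mx (fun z => U (- z) *m cof0 j).
  exact: trigpoly_mxM trigpoly_hlinN (trigpoly_mx_cst _).
have d2 := trigpoly_derivable_mx (k := i0) (y := y) tUP.
have d3 := trigpoly_derivable_mx (k := i0) (y := y) trigpoly_rot.
rewrite /Phi; under eq_fun do rewrite -lock; have [_ ->] := derivable_mxM d2 d3.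
by rewrite pmxM_cst// pmx_hlinN !mul0mx add0r pmx_rot -lock mulmxA.
Qed.

Lemma trigpoly_Psi : trigpoly_mx Psi.
Proof.
rewrite /Psi; under eq_fun do rewrite -lock.
apply: trigpoly_mxM trigpoly_hlin; apply: trigpoly_mxM (trigpoly_mx_cst _).
rewrite /rot; under eq_fun do rewrite sinN cosN.
apply: trigpoly_mxD; last first.
  by apply: trigpoly_mxZ (trigpoly_mx_cst _);
    apply: trigpolyB (tp_cst _ _) (tp_cos _).
apply: trigpoly_mxD (trigpoly_mx_cst _) _.
exact: trigpoly_mxZ (trigpolyN (tp_sin _)) (trigpoly_mx_cst _).
Qed.

(* Differentiate [Psi *m Phi = 1]. *)
Lemma pmx_Psi y : pmx i0 Psi y = - (L *m Psi y).
Proof.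
have d1 := trigpoly_derivable_mx (k := i0) (y := y) trigpoly_Psi.
have d2 := trigpoly_derivable_mx (k := i0) (y := y) trigpoly_Phi.
have [_] := derivable_mxM d1 d2.
have -> : (fun y => Psi y *m Phi y) = (fun=> 1%:M) by apply/funext => z;
  exact: PsiPhi.
rewrite pmx_cst pmx_Phi mulmxA PsiPhi mul1mx => /eqP.
rewrite eq_sym addr_eq0 => /eqP e.
by rewrite -[LHS]mulmx1 -(PhiPsi y) mulmxA e mulNmx.
Qed.

(** The operator with constant matrix A in the moving frame. By [pmx_frame] its t-derivative is the
    commutator with L, so differential equations along the leaves become matrix identities. *)
Definition frame (A : 'M[R]_N) (y : 'rV[R]_N) : 'M[R]_N := Phi y *m A *m Psi y.

Lemma trigpoly_frame A : trigpoly_mx (frame A).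
Proof.
apply: trigpoly_mxM trigpoly_Psi.
exact: trigpoly_mxM trigpoly_Phi (trigpoly_mx_cst _).
Qed.

Lemma pmx_frame A y : pmx i0 (frame A) y = frame (L *m A - A *m L) y.
Proof.
have d1 := trigpoly_derivable_mx (k := i0) (y := y) trigpoly_Phi.
have tPA : trigpoly_mx (fun z => Phi z *m A).
  exact: trigpoly_mxM trigpoly_Phi (trigpoly_mx_cst _).
have d2 := trigpoly_derivable_mx (k := i0) (y := y) tPA.
have d3 := trigpoly_derivable_mx (k := i0) (y := y) trigpoly_Psi.
have [_ ->] := derivable_mxM d2 d3.
rewrite pmxM_cst// pmx_Phi pmx_Psi /frame mulmxBr mulmxBl !mulmxA.
by congr (_ + _); rewrite mulmxN -!mulmxA.
Qed.

Lemma frameM A B y : frame A y *m frame B y = frame (A *m B) y.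
Proof. by rewrite /frame -!mulmxA (mulmxA (Psi y)) PsiPhi mul1mx. Qed.

Lemma frameD A B y : frame A y + frame B y = frame (A + B) y.
Proof. by rewrite /frame mulmxDr mulmxDl. Qed.

Lemma frameN A y : - frame A y = frame (- A) y.
Proof. by rewrite /frame mulmxN mulNmx. Qed.

Definition gram (y : 'rV[R]_N) : 'M[R]_N := Phi y *m gram0 j *m (Phi y)^T.

Lemma trigpoly_gram : trigpoly_mx gram.
Proof.
apply: trigpoly_mxM (trigpoly_mxT trigpoly_Phi).
exact: trigpoly_mxM trigpoly_Phi (trigpoly_mx_cst _).
Qed.

Lemma gram_tr y : (gram y)^T = gram y.
Proof. by rewrite /gram 2!trmx_mul trmxK gram0_tr mulmxA. Qed.

Lemma ip_congr n (A B : 'M[R]_n) u v : ip (A *m B *m A^T) u v =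
  ip B (u *m A) (v *m A).
Proof. by rewrite /ip trmx_mul !mulmxA. Qed.

Lemma Phi_neq0 y (u : 'rV[R]_N) : u != 0 -> u *m Phi y != 0.
Proof.
apply: contraNneq => uP; rewrite -[u]mulmx1 -(PhiPsi y) mulmxA uP mul0mx.
by [].
Qed.

Lemma gram_pos y (u : 'rV[R]_N) : u != 0 -> 0 < ip (gram y) u u.
Proof. by move=> u0; rewrite ip_congr; exact/gram0_form_gt0/Phi_neq0. Qed.

Lemma gram_unit y : gram y \in unitmx.
Proof.
rewrite -row_free_unit -kermx_eq0; apply/eqP/row_matrixP => a; rewrite row0.
set u := row a _; have uG : u *m gram y = 0 by rewrite -row_mul mulmx_ker row0.
apply: contra_eq (_ : ip (gram y) u u = 0) => [u0|];
  last by rewrite /ip uG mul0mx mxE.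
by rewrite gt_eqF// gram_pos.
Qed.

Lemma pmx_gram y : pmx i0 gram y =
  Phi y *m (L *m gram0 j + gram0 j *m L^T) *m (Phi y)^T.
Proof.
have d1 := trigpoly_derivable_mx (k := i0) (y := y) trigpoly_Phi.
have tPA : trigpoly_mx (fun z => Phi z *m gram0 j).
  exact: trigpoly_mxM trigpoly_Phi (trigpoly_mx_cst _).
have d2 := trigpoly_derivable_mx (k := i0) (y := y) tPA.
have d3 := trigpoly_derivable_mx (k := i0) (y := y) (trigpoly_mxT trigpoly_Phi).
have [_ ->] := derivable_mxM d2 d3.
rewrite pmxM_cst// pmxT pmx_Phi trmx_mul mulmxDr mulmxDl.
by rewrite !mulmxA.
Qed.

Lemma gram_row0 y : e0 *m gram y = e0 + 'e_i1 - y *m J.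
Proof.
by rewrite /gram !mulmxA e0_Phi e0_gram0 -[e0 in LHS]trmxK -trmx_mul Phi_e0 trmxK.
Qed.

Lemma gram_00 y : ip (gram y) e0 e0 = 1.
Proof. by rewrite ip_congr e0_Phi /ip e0_gram0 mxE (bigD1 i0)//= big1 ?addr0 =>
  [|c /negbTE c0]; rewrite !mxE ?c0 ?eqxx ?mulr1 ?mul0r. Qed.

Lemma cos_sin_2pi (k : int) (x : R) :
  cos (trigo.pi *+ 2 * k%:~R + x) = cos x /\ sin (trigo.pi *+ 2 * k%:~R + x) =
    sin x.
Proof.
case: k => n.
  have -> : trigo.pi *+ 2 * n%:~R + x = x + (trigo.pi *+ 2) *+ n.
    by rewrite addrC -pmulrn mulr_natr.
  by split; [exact: (periodicn (@cosD2pi R))|exact: (periodicn (@sinD2pi R))].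
have e : x = trigo.pi *+ 2 * (Negz n)%:~R + x + (trigo.pi *+ 2) *+ n.+1.
  by rewrite NegzE rmorphN /= -pmulrn -mulr_natr; ring.
by split; rewrite [in RHS]e; [rewrite (periodicn (@cosD2pi R))|rewrite
  (periodicn (@sinD2pi R))].
Qed.

(** The factor [U (- y)] of the coframe absorbs the left translation, and a lattice element shifts t
    by a multiple of 2 pi, the period of [rot]. *)
Lemma gram_invariant v y : hlat nil_heis v ->
  gram y = U v *m gram (hmul nil_heis v y) *m (U v)^T.
Proof.
move=> lv.
suff e : Phi y = U v *m Phi (hmul nil_heis v y) by rewrite /gram e trmx_mul !mulmxA.
rewrite /Phi -!lock !mulmxA hlinD; congr (_ *m _ *m _).
  apply/matrixP => a b; rewrite !hlinE; congr (_ + _ * _).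
  apply: eq_bigr => k _; rewrite /hmul !mxE.
  have [->|k1] := eqVneq k i1; first by rewrite symJ_1 !mulr0.
  by rewrite andbF mulr0; ring.
have [k vk] := lv i0.
have -> : hmul nil_heis v y 0 i0 = trigo.pi *+ 2 * k%:~R + y 0 i0.
  by rewrite /hmul !mxE vk /= /mper eqxx mulr0 addr0.
by have [c s] := cos_sin_2pi k (y 0 i0); rewrite /rot c s.
Qed.

End ModelMetric.

Section Curvature.
Context {R : realType} (j : nat).
Local Notation m := (j + j)%N.
Local Notation N := (4 + m)%N.
Local Notation J := (@symJ R j).
Local Notation i0 := (i0 j).
Local Notation i1 := (i1 j).
Local Notation L := (@rot_gen R j).
Local Notation e0 := (delta_mx 0 i0 : 'rV[R]_N).

Local Notation U := (hlin (@nil_heis R j)).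
Local Notation frame := (@frame R j).
Local Notation Phi := (@Phi R j).
Local Notation Psi := (@Psi R j).
Local Notation gram := (@gram R j).

(** * Connection and curvature *)

Definition covT : 'rV[R]_N -> 'M[R]_N := locked (frame (covT0 j)).
Definition jacobi_op : 'rV[R]_N -> 'M[R]_N := locked (frame (jacobi0 j)).

Lemma covTE : covT = frame (covT0 j). Proof. by rewrite /covT -lock. Qed.
Lemma jacobi_opE : jacobi_op = frame (jacobi0 j).
  Proof. by rewrite /jacobi_op -lock. Qed.

Lemma covT_00 y : e0 *m covT y = 0.
Proof. by rewrite covTE /frame !mulmxA e0_Phi e0_covT0 mul0mx. Qed.

(** The row g(T, .) = theta of the Gram matrix is affine, so its partials are the constants that
    make up d theta. *)
Lemma partial_GM0 i l y : partial i (fun z => gram z i0 l) y = - J i l.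
Proof.
have -> : (fun z => gram z i0 l) =
  (fun z => (e0 + 'e_i1 : 'rV[R]_N) 0 l - \sum_k z 0 k * J k l).
  apply/funext => z; rewrite -[LHS](_ : (e0 *m gram z) 0 l = _); last first.
    by rewrite -rowE [LHS]mxE.
  by rewrite gram_row0 [LHS]mxE; congr (_ + _); rewrite [LHS]mxE; congr (- _);
    rewrite mxE.
have dcst c : derivable (fun z : 'rV[R]_N => c : R) y 'e_i.
  exact/trigpoly_derivable/tp_cst.
have dz k : derivable (fun z : 'rV[R]_N => z 0 k) y 'e_i.
  exact/trigpoly_derivable/tp_coord.
have dk k : derivable (fun z : 'rV[R]_N => z 0 k * J k l) y 'e_i by exact:
  derivableM.
have [ds es] := partial_sum (index_enum 'I_N) dk.
rewrite /partial (deriveB (dcst _) ds) -![derive _ _ _]/(partial i _ y).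
rewrite partial_cst sub0r es; congr (- _); rewrite (bigD1 i)//= big1 ?addr0.
  by rewrite (partialM (dz i) (dcst _)) partial_cst partial_coord eqxx mulr0
    add0r mulr1.
move=> k ki; rewrite (partialM (dz k) (dcst _)) partial_cst partial_coord.
by rewrite eq_sym (negbTE ki) !mulr0 addr0.
Qed.

Lemma gram_symE z a b : gram z a b = gram z b a.
Proof. by rewrite -[in LHS]gram_tr [LHS]mxE. Qed.

Lemma christoffel_sym k a b y : christoffel gram k a b y = christoffel gram k b a y.
Proof.
rewrite /christoffel; congr (_ * _); apply: eq_bigr => l _; congr (_ * (_ - _)).
  by rewrite addrC.
by congr (partial l _ y); apply/funext => z; exact: gram_symE.
Qed.

Lemma covT_gram y : 2 *: (covT y *m gram y) = pmx i0 gram y - 2 *: J.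
Proof.
rewrite pmx_gram -(Phi_symJ y) covTE /frame /gram !mulmxA -(mulmxA _ (Psi y))
  PsiPhi mulmx1.
rewrite -(mulmxA (Phi y) (covT0 j)) covT0_gram0.
rewrite mulmxBr mulmxBl scalerBr; congr (_ - _).
by rewrite -scalemxAr -scalemxAl scalerA mulfV ?scale1r// pnatr_eq0.
Qed.

(** Koszul in coordinates: the t-derivative of the Gram matrix is the Lie derivative term, and the
    two other partials are derivatives of theta and add up to - 2 J. *)
Lemma christoffel_0 k a y : christoffel gram k a i0 y = covT y a k.
Proof.
have -> : christoffel gram k a i0 y =
  (2^-1 *: ((pmx i0 gram y - 2 *: J) *m invmx (gram y))) a k.
  rewrite /christoffel !mxE; congr (_ * _); apply: eq_bigr => l _.
  rewrite mulrC; congr (_ * _); last first.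
    have /matrixP/(_ k l) : (invmx (gram y))^T =
      invmx (gram y) by rewrite trmx_inv gram_tr.
    by rewrite [LHS]mxE.
  have -> : (pmx i0 gram y - 2 *: J) a l =
    partial i0 (fun z => gram z a l) y - 2 * J a l.
    by rewrite !mxE.
  rewrite !partial_GM0.
  have -> : partial l (fun z => gram z a i0) y = - J l a.
    rewrite -(partial_GM0 l a y); congr (partial l _ y); apply/funext => z;
      exact: gram_symE.
  have /matrixP/(_ l a) := @symJ_antisym R j; rewrite [LHS]mxE [RHS]mxE => e.
  by rewrite e; ring.
rewrite -covT_gram -scalemxAl scalerA mulVf ?pnatr_eq0// scale1r -mulmxA.
by rewrite mulmxV ?gram_unit// mulmx1.
Qed.

Lemma near_nabla (X X' Y Y' : 'rV[R]_N -> 'rV[R]_N) (y : 'rV[R]_N) :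
  X y = X' y -> {near y, Y =1 Y'} -> nabla gram X Y y = nabla gram X' Y' y.
Proof.
move=> XX YY; apply/rowP => k; rewrite !mxE XX; congr (_ + _).
  apply: eq_bigr => i _; congr (_ * _).
  apply: (nbhs_singleton (near_partial i _)).
  by apply: filterS YY => z ->.
by apply: eq_bigr => i _; apply: eq_bigr => l _; rewrite (nbhs_singleton YY).
Qed.

Lemma nabla_cst_e0 X c y : nabla gram X (fun=> c *: e0) y = c *: (X y *m covT y).
Proof.
apply/rowP => k; rewrite !mxE big1 ?add0r => [|i _]; last first.
  by rewrite partial_cst mulr0.
rewrite mulr_sumr; apply: eq_bigr => i _.
rewrite (bigD1 i0)//= big1 ?addr0 => [|l /negbTE l0];
  last by rewrite !mxE l0 !mulr0.
by rewrite christoffel_0 !mxE !eqxx /= mulr1; ring.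
Qed.

(** Absence of torsion: nabla_T Y = [T, Y] + nabla_Y T, where [T, Y] is the t-derivative of the
    components of Y. *)
Lemma nabla_e0 Y c y :
  nabla gram (fun=> c *: e0) Y y = c *: (pmx i0 Y y + Y y *m covT y).
Proof.
apply/rowP => k; rewrite !mxE mulrDr; congr (_ + _).
  rewrite (bigD1 i0)//= big1 ?addr0 => [|l /negbTE l0].
    by rewrite !mxE !eqxx mulr1.
  by rewrite !mxE l0 mulr0 mul0r.
rewrite (bigD1 i0)//= [X in _ + X]big1 ?addr0 => [|l /negbTE l0]; last first.
  by apply: big1 => i _; rewrite !mxE l0 !mulr0 mul0r.
rewrite mulr_sumr; apply: eq_bigr => i _.
by rewrite christoffel_sym christoffel_0 !mxE !eqxx /= mulr1; ring.
Qed.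

(** As nabla_T T = 0, only nabla_T nabla_U T and nabla_[U,T] T remain, and the derivatives of U
    cancel between them. A general factor c covers both unit fields and the unnormalised vectors of
    a mixed plane. *)
Lemma RT_near c (T U' : 'rV[R]_N -> 'rV[R]_N) (y : 'rV[R]_N) :
  {near y, T =1 fun=> c *: e0} -> derivable_mx i0 U' y ->
  RT gram T U' y = (c * c) *: (U' y *m jacobi_op y).
Proof.
move=> Tc dU; have nTc := near_join Tc; have Ty := nbhs_singleton Tc.
rewrite /RT /curv.
have -> : nabla gram U' (nabla gram T T) y = 0.
  rewrite (@near_nabla U' U' _ (fun=> 0 *: e0))//.
    by rewrite nabla_cst_e0 scale0r.
  near=> z; rewrite (@near_nabla T (fun=> c *: e0) T (fun=> c *: e0)); last 2 first.
  - by near: z.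
  - by near: z.
  by rewrite nabla_e0 pmx_cst add0r -scalemxAl covT_00 !scaler0 scale0r.
have -> : nabla gram T (nabla gram U' T) y =
    (c * c) *: (pmx i0 (fun z => U' z *m covT z) y + U' y *m covT y *m covT y).
  rewrite (@near_nabla T (fun=> c *: e0) _ (fun z => U' z *m (c *: covT z)));
    last 2 first.
  - exact: Ty.
  - near=> z; rewrite (@near_nabla U' U' T (fun=> c *: e0))//; last by near: z.
    by rewrite nabla_cst_e0 scalemxAr.
  rewrite nabla_e0; have dC : derivable_mx i0 covT y.
    rewrite covTE; exact/trigpoly_derivable_mx/trigpoly_frame.
  have [dUC _] := derivable_mxM dU dC.
  have -> : pmx i0 (fun z => U' z *m (c *: covT z)) y =
    c *: pmx i0 (fun z => U' z *m covT z) y.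
    have -> : (fun z => U' z *m (c *: covT z)) = (fun z => U' z *m covT z *m c%:M).
      by apply/funext => z; rewrite [RHS]mul_mx_scalar [RHS]scalemxAr.
    by rewrite (pmxM_cst _ dUC) mul_mx_scalar.
  by rewrite -scalemxAr -scalemxAl -scalerDr scalerA.
have -> : nabla gram (bracket U' T) T y = - ((c * c) *: (pmx i0 U' y *m covT y)).
  rewrite (@near_nabla _ (bracket U' T) T (fun=> c *: e0))// nabla_cst_e0.
  have -> : bracket U' T y = - (c *: pmx i0 U' y).
    apply/rowP => k; rewrite !mxE (bigD1 i0)//= big1 ?addr0.
      have -> : partial i0 (fun z => T z 0 k) y = 0.
        rewrite -[LHS](_ : pmx i0 T y 0 k = _); last by rewrite mxE.
        by rewrite (near_pmx i0 Tc) pmx_cst mxE.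
      by rewrite mulr0 sub0r Ty !mxE !eqxx mulr1.
    move=> l /negbTE l0.
    have -> : partial l (fun z => T z 0 k) y = 0.
      rewrite -[LHS](_ : pmx l T y 0 k = _); last by rewrite mxE.
      by rewrite (near_pmx l Tc) pmx_cst mxE.
    by rewrite mulr0 sub0r Ty !mxE l0 mulr0 mul0r oppr0.
  by rewrite mulNmx scalerN -scalemxAl scalerA.
have dC : derivable_mx i0 covT y by rewrite covTE;
  exact/trigpoly_derivable_mx/trigpoly_frame.
have [_ ->] := derivable_mxM dU dC.
(* The Riccati equation, transported from the moving frame by [jacobi0E]. *)
have -> : jacobi_op y = - (pmx i0 covT y + covT y *m covT y).
  by rewrite covTE jacobi_opE pmx_frame frameM frameD jacobi0E frameN opprK.
rewrite mulmxN mulmxDr mulmxA sub0r opprK.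
move: (pmx i0 U' y *m covT y) (U' y *m pmx i0 covT y) (U' y *m covT y *m covT
  y) => A B D.
by apply/rowP => k; rewrite !mxE; ring.
Unshelve. all: by end_near. Qed.

End Curvature.

Section InnerProduct.
Context {R : realType} {n : nat}.

Lemma ipDl (A : 'M[R]_n) (x y w : 'rV[R]_n) : ip A (x + y) w = ip A x w + ip A y w.
Proof. by rewrite /ip !mulmxDl mxE. Qed.

Lemma ipZl (A : 'M[R]_n) (a : R) (x w : 'rV[R]_n) : ip A (a *: x) w = a * ip A x w.
Proof. by rewrite /ip -!scalemxAl mxE. Qed.

Lemma ipZr (A : 'M[R]_n) (a : R) (x w : 'rV[R]_n) : ip A x (a *: w) = a * ip A x w.
Proof. by rewrite /ip linearZ /= -scalemxAr mxE. Qed.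

End InnerProduct.

Section Charts.
Context {R : realType} {n : nat} (H : heis R n).

Lemma hchart_self (a y : 'rV[R]_n) : ball a 2^-1 y ->
  {near y, transition (hchart H a) (hchart H a) =1 id}.
Proof.
move=> ay; have : \near y, ball a 2^-1 y.
  by apply: open_nbhs_nbhs; split=> //; exact: ball_open.
by apply: filterS => z az; rewrite /transition /local_rep /= hsecK.
Qed.

Lemma hchart_near (a b y : 'rV[R]_n) : ball a 2^-1 y -> hdom b (hpi H y) ->
  exists v, [/\ hlat H v, hsec b (hpi H y) = hmul H v y,
    {near y, transition (hchart H a) (hchart H b) =1 hmul H v} &
    jac (transition (hchart H a) (hchart H b)) y = hlin H v].
Proof.
move=> ay /hsec_near[v lv nv]; exists v; split=> //.
  exact: (nbhs_singleton nv).
apply: (@jac_affine R n n (hlin H v) v); apply: filterS nv => z zE.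
by rewrite /transition /local_rep /= zE hmulE.
Qed.

End Charts.

(** * The foliated nilmanifold: total geodesy and mixed curvature *)

Section Model.
Context {R : realType} (j : nat).
Local Notation m := (j + j)%N.
Local Notation N := (4 + m)%N.
Local Notation J := (@symJ R j).
Local Notation i0 := (i0 j).
Local Notation i1 := (i1 j).
Local Notation e0 := (delta_mx 0 i0 : 'rV[R]_N).
Local Notation nil_heis := (@nil_heis R j).
Local Notation gram := (@gram R j).

Definition nilmfd : manifold R N := hmfd nil_heis.

Lemma metric_change (c d : chart R N nilmfd) x : atlas c -> atlas d ->
  cdom c x -> cdom d x ->
  gram (cmap c x) = jac (transition c d) (cmap c x) *m gram (cmap d x)
                  *m (jac (transition c d) (cmap c x))^T.
Proof.
move=> [a _ <-] [b _ <-] /= ax bx; have [aa ea] := hsecP ax.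
have bx' : hdom b (hpi nil_heis (hsec a x)) by rewrite ea.
have [v [lv vE _ ->]] := hchart_near aa bx'; rewrite ea in vE.
by rewrite vE; exact: gram_invariant.
Qed.

(** One Gram matrix serves all charts: chart coordinates are lifts to R^N, and [gram_invariant]
    compares two lifts of the same point. *)
Definition nilmetric : metric nilmfd.
refine (@Metric R N nilmfd (fun _ => gram) _ _ _ metric_change).
- by move=> c _ a b; apply/smooth_onE => y _; exact/trigpoly_smooth/trigpoly_gram.
- by move=> c y _ _; exact: gram_tr.
- by move=> c y u _ _; exact: gram_pos.
Defined.

Lemma hlin_row0 v (i k : 'I_N) : (i < 1)%N -> (1 <= k)%N -> hlin nil_heis v i k = 0.
Proof.
move=> i1 k1; have -> : i = i0 by apply/val_inj/eqP; rewrite /= -leqn0 -ltnS.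
have -> : hlin nil_heis v i0 k =
  (e0 *m hlin nil_heis v) 0 k by rewrite -rowE [RHS]mxE.
by rewrite e0_hlin mxE eqxx /= -val_eqE /= gtn_eqF.
Qed.

Lemma foliation_cube (c : chart R N nilmfd) : (range (@hchart R N nil_heis)) c ->
  exists x, exists2 r, 0 < r & cimg c = ball x r.
Proof. by move=> [a _ <-]; exists a, 2^-1 => //; exact: hsec_img. Qed.

Lemma foliation_change (c d : chart R N nilmfd) x (i k : 'I_N) :
  (range (@hchart R N nil_heis)) c -> (range (@hchart R N nil_heis)) d ->
  cdom c x -> cdom d x -> (i < 1)%N -> (1 <= k)%N ->
  jac (transition c d) (cmap c x) i k = 0.
Proof.
move=> [a _ <-] [b _ <-] /= ax bx i1 k1; have [aa ea] := hsecP ax.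
have bx' : hdom b (hpi nil_heis (hsec a x)) by rewrite ea.
have [v [_ _ _ ->]] := hchart_near aa bx'.
exact: hlin_row0.
Qed.

(** The manifold atlas is itself foliated: its images are cubes, and the linear parts of its
    transitions fix the t-direction. *)
Definition nilfol : foliation nilmfd 1 :=
  @Foliation R N nilmfd 1 (range (@hchart R N nil_heis)) (@atlas_cover _ _ nilmfd)
    (@atlas_compatible _ _ nilmfd) foliation_cube foliation_change.

Lemma tangentP (c : chart R N nilmfd) y v : atlas c -> cimg c y ->
  tangent nilfol c y v <-> v = v 0 i0 *: e0.
Proof.
move=> [a _ <-]; rewrite (_ : cimg _ = ball a 2^-1); last exact: hsec_img.
move=> ay; split=> [tv|vE].
  have dy : cdom (hchart nil_heis a) (cinv (hchart nil_heis a) y) by exists y.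
  have /(_ _) := tv (hchart nil_heis a) _ dy;
    rewrite (jac_affine (A := 1%:M) (v := 0)); last first.
    by apply: filterS (hchart_self nil_heis ay) => z ->; rewrite mulmx1 addr0.
  rewrite mulmx1 => v0; apply/rowP => k; rewrite !mxE eqxx /=.
  have [->|k0] := eqVneq k i0; first by rewrite mulr1.
  rewrite mulr0; apply: v0; first by exists a.
  by rewrite lt0n; apply: contraNneq k0 => k0; apply/eqP/val_inj.
move=> d [b _ <-] /= by_ k k1.
have [v' [_ _ _ ->]] := hchart_near ay by_.
have k0 : (k == i0) = false by apply/negbTE; apply: contraTneq k1 => ->.
by rewrite vE -scalemxAl e0_hlin !mxE k0 mulr0.
Qed.

(** The connection term is a multiple of nabla_T T = 0 ([covT_00]), and the components of Y other
    than the t-component vanish on all of V together with their derivatives. *)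
Lemma totally_geodesic_nilfol : totally_geodesic nilmetric nilfol.
Proof.
move=> c ac V oV Vc X Y sX sY XY y Vy; have cy := Vc _ Vy.
have nV : \near y, V y by exact: open_nbhs_nbhs.
have [/(tangentP _ ac cy) Xy /(tangentP _ ac cy) Yy] := XY y Vy.
apply/(tangentP _ ac cy).
have -> : nabla (gm nilmetric c) X Y y = nabla gram (fun=> X y 0 i0 *: e0) Y y.
  by apply: near_nabla => //; exact: near_all.
rewrite nabla_e0 Yy -scalemxAl covT_00 scaler0 addr0.
suff -> : pmx i0 Y y = pmx i0 Y y 0 i0 *: e0.
  by rewrite scalerA [X in X *: _]mulrC ?scalerA; apply/rowP => k;
    rewrite !mxE !eqxx !mulr1; ring.
apply/rowP => k; rewrite [RHS]mxE [X in _ * X]mxE eqxx /=.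
have [->|k0] := eqVneq k i0; first by rewrite mulr1.
rewrite mulr0 mxE.
have nY : {near y, (fun z => Y z 0 k) =1 fun=> 0}.
  apply: filterS nV => z Vz; have [_ /(tangentP _ ac (Vc _ Vz)) ->] := XY z Vz.
  by rewrite !mxE (negbTE k0) mulr0.
by rewrite (nbhs_singleton (near_partial i0 nY)) partial_cst.
Qed.

Lemma orthogonalP y (u : 'rV[R]_N) : ip (gram y) u e0 = 0 -> (u *m Phi y) 0 i0 = 0.
Proof.
rewrite ip_congr e0_Phi /ip -mulmxA -[gram0 j]gram0_tr -trmx_mul e0_gram0.
by rewrite trmx_delta -colE mxE.
Qed.

Lemma jacobi_op_form y u : ip (gram y) (u *m jacobi_op y) u =
  ip (jacobi0 j *m gram0 j) (u *m Phi y) (u *m Phi y).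
Proof.
rewrite ip_congr jacobi_opE /frame; congr (_ 0 0); rewrite !mulmxA.
by rewrite -(mulmxA _ (Psi y)) PsiPhi mulmx1.
Qed.

(** In the moving frame the numerator is a positive multiple of the diagonal form
    [jacobi0 *m gram0], which degenerates on the theta direction alone. *)
Lemma Kmix_positive_nilfol : Kmix_positive nilmetric nilfol.
Proof.
move=> c ac y cy u t u0 t0 ou /[dup] tt /(tangentP _ ac cy) tE.
have ut := ou _ tt; rewrite /= in ut.
have ta0 : t 0 i0 != 0 by apply: contraNneq t0 => ta0; rewrite tE ta0 scale0r.
rewrite /sectional /= ut expr0n /= subr0.
apply: divr_gt0; last by apply: mulr_gt0; exact: gram_pos.
have -> : curv gram (fun=> u) (fun=> t) (fun=> t) y =
  (t 0 i0 * t 0 i0) *: (u *m jacobi_op y).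
  rewrite -[LHS]/(RT gram (fun=> t) (fun=> u) y);
    apply: (@RT_near _ _ _ _ (fun=> u)).
    exact: near_all.
  by move=> a b; exact: derivable_cst.
rewrite /ip -!scalemxAl mxE; apply: mulr_gt0.
  by rewrite -expr2 lt_def sqrf_eq0 ta0 sqr_ge0.
rewrite -/(ip (gram y) (u *m jacobi_op y) u) jacobi_op_form;
  apply: jacobi0_form_gt0; first exact: Phi_neq0.
apply: orthogonalP; move: ut; rewrite tE /ip linearZ /= -scalemxAr mxE => /eqP.
by rewrite mulf_eq0 (negbTE ta0) => /eqP.
Qed.

End Model.

(** * Leaves, geodesics and the circle fibration *)

Section Fibration.
Context {R : realType} (j : nat).
Local Notation m := (j + j)%N.
Local Notation N := (4 + m)%N.
Local Notation NB := (3 + m)%N.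
Local Notation J := (@symJ R j).
Local Notation i0 := (i0 j).
Local Notation i1 := (i1 j).
Local Notation e0 := (delta_mx 0 i0 : 'rV[R]_N).
Local Notation nil_heis := (@nil_heis R j).
Local Notation gram := (@gram R j).
Local Notation nilmfd := (@nilmfd R j).
Local Notation nilmetric := (@nilmetric R j).
Local Notation nilfol := (@nilfol R j).

Implicit Types (y v : 'rV[R]_N) (x : nilmfd) (s : R).

(** [4 + m] is convertible to [1 + NB], so forgetting t is the splitting of the first coordinate. *)
Definition shift_ix (a : 'I_NB) : 'I_N := rshift 1 a.

Lemma shift_ix_inj : injective shift_ix.
Proof. exact: (@rshift_inj 1 NB). Qed.

Lemma index_case (i : 'I_N) : i = i0 \/ exists a, i = shift_ix a.
Proof.
case: (@split_ordP 1 NB i) => a ->; last by right; exists a.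
by left; apply: val_inj; rewrite /= ord1.
Qed.

Lemma shift_ix_neq0 a : (shift_ix a == i0) = false.
Proof. by []. Qed.

Lemma sum_index (F : 'I_N -> R) : \sum_i F i = F i0 + \sum_a F (shift_ix a).
Proof.
rewrite (@big_split_ord _ _ _ 1 NB) /= big_ord1; congr (F _ + _).
exact: val_inj.
Qed.

Definition i1B : 'I_NB := @Ordinal NB 0 isT.

Lemma shift_ix_i1B : shift_ix i1B = i1.
Proof. exact: val_inj. Qed.

Definition base_form : 'M[R]_NB := \matrix_(a, b) J (shift_ix a) (shift_ix b).

Definition glue (s : R) (b : 'rV[R]_NB) : 'rV[R]_N :=
  locked (row_mx (s%:M : 'rV[R]_1) b : 'rV[R]_(1 + NB)).

Definition tail (y : 'rV[R]_N) : 'rV[R]_NB := \row_a y 0 (shift_ix a).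

Lemma glue0 s b : glue s b 0 i0 = s.
Proof.
have -> : i0 = lshift NB (0 : 'I_1) :> 'I_(1 + NB) by exact: val_inj.
by rewrite /glue -lock (@row_mxEl _ _ 1 NB) mxE.
Qed.

Lemma glue_shift_ix s b a : glue s b 0 (shift_ix a) = b 0 a.
Proof. by rewrite /glue -lock; exact: (@row_mxEr _ _ 1 NB). Qed.

Lemma tail_glue s b : tail (glue s b) = b.
Proof. by apply/rowP => a; rewrite mxE glue_shift_ix. Qed.

Lemma glue_tail y : glue (y 0 i0) (tail y) = y.
Proof.
apply/rowP => i; have [->|[a ->]] := index_case i; first by rewrite glue0.
by rewrite glue_shift_ix mxE.
Qed.

Lemma symJ_c0 i : J i i0 = 0.
Proof.
have /matrixP/(_ i i0) := @symJ_antisym R j; rewrite [LHS]mxE [RHS]mxE symJ_0 => ?.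
lra.
Qed.

Lemma glue_form (s s' : R) (b b' : 'rV[R]_NB) :
  (glue s b *m J *m (glue s' b')^T) 0 0 = (b *m base_form *m b'^T) 0 0.
Proof.
rewrite !mxE sum_index [X in X + _](_ : _ = 0) ?add0r; last first.
  rewrite mxE big1 ?mul0r// => i _; by rewrite symJ_c0 mulr0.
apply: eq_bigr => a _; rewrite [X in _ * X]mxE glue_shift_ix [X in _ = _ * X]mxE.
congr (_ * _); rewrite !mxE sum_index symJ_0 mulr0 add0r.
by apply: eq_bigr => c _; rewrite glue_shift_ix mxE.
Qed.

Lemma base_form_antisym : base_form^T = - base_form.
Proof.
apply/matrixP => a b; rewrite !mxE.
by have /matrixP/(_ (shift_ix a) (shift_ix b)) := @symJ_antisym R j;
  rewrite [LHS]mxE [RHS]mxE.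
Qed.

Lemma base_form_center a : base_form i1B a = 0.
Proof. by rewrite mxE shift_ix_i1B symJ_1. Qed.

Lemma glue_lat (b : 'rV[R]_NB) k :
  (forall a, exists k : int, b 0 a = 1 * k%:~R) ->
  hlat nil_heis (glue (trigo.pi *+ 2 * k%:~R) b).
Proof.
move=> lb i; have [->|[a ->]] := index_case i.
  by exists k; rewrite glue0 /= /mper eqxx.
by have [l bl] := lb a; exists l; rewrite glue_shift_ix bl /= /mper shift_ix_neq0.
Qed.

Lemma base_form_int (v w : 'rV[R]_NB) :
  (forall a, exists k : int, v 0 a = 1 * k%:~R) ->
  (forall a, exists k : int, w 0 a = 1 * k%:~R) ->
  exists k : int, (v *m base_form *m w^T) 0 0 = 1 * k%:~R.
Proof.
(* The base lattice is lifted with t-entry 0, written as a multiple of 2 pi to fit [glue_lat];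
   integrality is then inherited from the total space. *)
move=> lv lw; rewrite -(glue_form (trigo.pi *+ 2 * 0%:~R) (trigo.pi *+ 2 * 0%:~R)).
by have [k ->] := symJ_lattice (glue_lat 0 lv) (glue_lat 0 lw); exists k.
Qed.

Definition base_heis : heis R NB :=
  Heis base_form_antisym base_form_center (fun=> lexx 1) base_form_int.

Definition basemfd : manifold R NB := hmfd base_heis.

Lemma tail_hmul v y : tail (hmul nil_heis v y) = hmul base_heis (tail v) (tail y).
Proof.
apply/rowP => a; rewrite mxE /hmul.
have -> : hform nil_heis v y = hform base_heis (tail v) (tail y).
  by rewrite -{1}(glue_tail v) -{1}(glue_tail y); exact: glue_form.
by rewrite !mxE -[hz nil_heis]/i1 -[hz base_heis]/i1B -shift_ix_i1B (inj_eq
  shift_ix_inj).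
Qed.

Lemma tail_lat v : hlat nil_heis v -> hlat base_heis (tail v).
Proof.
move=> lv a; have [k vk] := lv (shift_ix a); exists k.
by rewrite mxE vk /= /mper shift_ix_neq0.
Qed.

Definition base_proj (x : nilmfd) : basemfd := hpi base_heis (tail (hrep x)).

Lemma prE y : base_proj (hpi nil_heis y) = hpi base_heis (tail y).
Proof.
have /esym/hpiP[v lv e] := hrepK (hpi nil_heis y).
by rewrite /base_proj e tail_hmul hpi_mul//; exact: tail_lat.
Qed.

Definition tailmx : 'M[R]_(N, NB) := \matrix_(i, a) (i == shift_ix a)%:R.

Lemma tailmxE y : tail y = y *m tailmx.
Proof.
apply/rowP => a; rewrite !mxE (bigD1 (shift_ix a))//= big1 ?addr0.
  by rewrite mxE eqxx mulr1.
by move=> i ia; rewrite mxE (negbTE ia) mulr0.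
Qed.

Lemma tail_continuous : continuous tail.
Proof.
have -> : tail = (fun y => y *m tailmx + 0).
  by apply/funext => y; rewrite addr0 tailmxE.
exact: affine_continuous.
Qed.

Lemma base_proj_continuous : continuous base_proj.
Proof.
suff c : continuous (base_proj \o hpi nil_heis) by apply/quotient_continuous;
  exact: c.
have -> : base_proj \o hpi nil_heis =
  hpi base_heis \o tail by apply/funext => z; exact: prE.
move=> y; apply: continuous_comp; first exact: tail_continuous.
exact: hpi_continuous.
Qed.

(** The flow of T commutes with left translations, so it descends to the quotient. *)
Lemma hmul_e0 v y s : hmul nil_heis v (y + s *: e0) = hmul nil_heis v y + s *: e0.
Proof.
rewrite /hmul hformDr (_ : hform nil_heis v (s *: e0) = 0).
  by rewrite addr0; apply/rowP => i; rewrite !mxE; ring.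
rewrite /hform linearZ /= -scalemxAr mxE -mulmxA.
rewrite [X in _ *m X](_ : _ = 0) ?mulmx0 ?mxE ?mulr0//.
by rewrite trmx_delta -colE; apply/colP => k; rewrite [LHS]mxE symJ_c0 mxE.
Qed.

Lemma tail_eq y y' : tail y = tail y' -> y' = y + (y' 0 i0 - y 0 i0) *: e0.
Proof.
move=> e; apply/rowP => i; rewrite !mxE; have [->|[a ->]] := index_case i.
  by rewrite eqxx /= mulr1; ring.
by have /rowP/(_ a) := e; rewrite !mxE shift_ix_neq0 mulr0 addr0.
Qed.

Lemma e0_form v s : hform nil_heis (s *: e0) v = 0.
Proof. by rewrite /hform -!scalemxAl e0_J mul0mx scaler0 mxE. Qed.

Lemma e0_lat k : hlat nil_heis ((trigo.pi *+ 2 * k%:~R) *: e0).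
Proof.
move=> i; rewrite !mxE; have [->|[a ->]] := index_case i.
  by exists k; rewrite eqxx mulr1 /= /mper eqxx.
by exists 0; rewrite shift_ix_neq0 !mulr0.
Qed.

Lemma hpi_period y k : hpi nil_heis (y + (trigo.pi *+ 2 * k%:~R) *: e0) =
  hpi nil_heis y.
Proof.
apply/esym/hpiP; exists ((trigo.pi *+ 2 * k%:~R) *: e0); first exact: e0_lat.
by rewrite /hmul e0_form scale0r addr0 addrC.
Qed.

Lemma base_proj_fibre x y : base_proj x = base_proj (hpi nil_heis y) ->
  exists s, x = hpi nil_heis (y + s *: e0).
Proof.
rewrite prE => /esym/hpiP[w lw e].
(* Once the base translation is lifted to the total lattice, the two lifts differ in the
   t-coordinate only. *)
have lw' : hlat nil_heis (glue (trigo.pi *+ 2 * 0%:~R) w) by exact: glue_lat.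
move: lw'; set v := glue _ w => lv.
have e' : tail (hmul nil_heis v y) = tail (hrep x) by rewrite tail_hmul tail_glue.
have := tail_eq e'; rewrite -hmul_e0 => /(congr1 (hpi nil_heis)).
by rewrite hrepK hpi_mul// => ->; eexists.
Qed.

Definition orbit_path y (s : R) : nilmfd := hpi nil_heis (y + s *: e0).

Lemma same_plaque_base_proj x x' : same_plaque nilfol x x' ->
  base_proj x = base_proj x'.
Proof.
move=> [_ [[a _ <-]]] /= ax ax' h.
rewrite -(hsec_pi ax) -(hsec_pi ax') !prE; congr hpi.
by apply/rowP => b; rewrite !mxE; apply: h.
Qed.

Lemma leaf_base_proj x x' : leaf nilfol x x' -> base_proj x = base_proj x'.
Proof. by elim=> //[a b /same_plaque_base_proj|a b c _ -> _ ->]. Qed.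

Lemma same_plaque_near y s : `|s| < 2^-1 ->
  same_plaque nilfol (hpi nil_heis y) (hpi nil_heis (y + s *: e0)).
Proof.
move=> s1; have b1 : ball y 2^-1 y by exact: ballxx.
have b2 : ball y 2^-1 (y + s *: e0).
  apply/ball_rVE => // i; rewrite !mxE opprD addrA subrr sub0r normrN normrM.
  apply: le_lt_trans s1; rewrite ler_piMr//; case: (_ && _) => /=.
    by rewrite normr1.
  by rewrite normr0.
exists (hchart nil_heis y); split; first by exists y.
- by exists y.
- by exists (y + s *: e0).
move=> k k1 /=; rewrite !hsecK// !mxE (_ : (k == i0) = false) ?mulr0 ?addr0//.
by apply/negbTE; apply: contraTneq k1 => ->.
Qed.

Lemma leaf_path n y s : `|s| < n.+1%:R / 2 ->
  leaf nilfol (hpi nil_heis y) (hpi nil_heis (y + s *: e0)).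
Proof.
elim: n y s => [|n ih] y s sn.
  by apply: rst_step; apply: same_plaque_near; rewrite mul1r in sn.
(* Splitting off one of n + 2 equal pieces: the first n + 1 fall under the induction hypothesis, and
   the last, shorter than 1/2, stays in a single plaque. *)
pose s' := s * (n.+1%:R / n.+2%:R).
have n2 : 0 < n.+2%:R :> R by [].
have n1 : 0 < n.+1%:R :> R by [].
have e1 : n.+2%:R = n.+1%:R + 1 :> R by rewrite -natr1.
have sn' : `|s| / n.+2%:R < 2^-1 by rewrite ltr_pdivrMr// mulrC.
apply: (@rst_trans _ _ _ (hpi nil_heis (y + s' *: e0))).
  apply: ih; rewrite /s' normrM (ger0_norm (divr_ge0 (ltW n1) (ltW n2))).
  by rewrite mulrCA ltr_pM2l// .
have -> : y + s *: e0 = (y + s' *: e0) + (s / n.+2%:R) *: e0.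
  rewrite -addrA -scalerDl /s'; congr (_ + _ *: _).
  have : n.+2%:R != 0 :> R by rewrite gt_eqF.
  by rewrite e1 => ?; field.
apply: rst_step; apply: same_plaque_near.
by rewrite normrM normfV (ger0_norm (ltW n2)).
Qed.

Lemma leaf_range x : leaf nilfol x = range (orbit_path (hrep x)).
Proof.
apply/seteqP; split=> [x' /leaf_base_proj e|_ [s _ <-]].
  have [s ->] : exists s, x' = hpi nil_heis (hrep x + s *: e0).
    by apply: base_proj_fibre; rewrite hrepK.
  by exists s.
have [n sn] : exists n : nat, `|s| < n.+1%:R / 2.
  exists (Num.bound (`|s| * 2)).
  rewrite ltr_pdivlMr//; apply: lt_trans (archi_boundP _) _; first exact: mulr_ge0.
  by rewrite ltr_nat.
by rewrite -{1}(hrepK x); exact: leaf_path sn.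
Qed.

Lemma leaf_fibre x : leaf nilfol x = base_proj @^-1` [set base_proj x].
Proof.
apply/seteqP; split=> [x' /leaf_base_proj e|x' /= e]; first exact/esym.
rewrite leaf_range; have [s ->] : exists s, x' = hpi nil_heis (hrep x + s *: e0).
  by apply: base_proj_fibre; rewrite hrepK.
by exists s.
Qed.

Lemma base_proj_surj : range base_proj = setT.
Proof.
apply/seteqP; split=> // b _; exists (hpi nil_heis (glue 0 (hrep b))) => //.
by rewrite prE tail_glue hrepK.
Qed.

Lemma near_derive1n (f g : R -> R) k s :
  {near s, f =1 g} -> {near s, derive1n k f =1 derive1n k g}.
Proof.
move=> fg; elim: k => // k /near_join ih; rewrite !derive1nS.
near=> t; rewrite !derive1E; apply: near_eq_derive.
by near: t.
Unshelve. all: by end_near. Qed.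

Lemma derive1_affine (a b : R) : derive1 (fun r : R => a + r * b) = fun=> b.
Proof.
apply/funext => s; rewrite derive1E.
have d1 : derivable (fun r : R => r) s 1 by exact: derivable_id.
have dc (c : R) : derivable (fun r : R => c) s 1 by exact: derivable_cst.
rewrite (deriveD (dc a) (derivableM d1 (dc b))) (deriveM d1 (dc b)).
by rewrite !derive_cst derive_id scaler0 !add0r; exact: mulr1.
Qed.

Lemma derive1n_affine (a b : R) k :
  exists a' b', derive1n k (fun r : R => a + r * b) = fun r : R => a' + r * b'.
Proof.
elim: k => [|k [a' [b' e]]]; first by exists a, b.
exists b', 0; rewrite derive1nS e derive1_affine; apply/funext => r.
by rewrite mulr0 addr0.
Qed.

Lemma derivable_affine (a b s : R) : derivable (fun r : R => a + r * b) s 1.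
Proof.
by apply: derivableD; [exact: derivable_cst|apply: derivableM;
  [exact: derivable_id|exact: derivable_cst]].
Qed.

Lemma path_continuous y : continuous (fun s : R => y + s *: e0).
Proof.
move=> s; apply: rV_continuous_at => a i.
rewrite (_ : (fun t => _) = (fun t => y a i + t * e0 a i)).
  exact/differentiable_continuous/derivable1_diffP/derivable_affine.
by apply/funext => t; rewrite !mxE.
Qed.

Lemma orbit_path_continuous y : continuous (orbit_path y).
Proof.
move=> s; apply: (@continuous_comp _ _ _ (fun s : R => y + s *: e0) (hpi nil_heis)).
  exact: path_continuous.
exact: hpi_continuous.
Qed.

(** Near each time a chart reads the path as a straight line in direction e0, so the second
    derivative vanishes and the quadratic term is nabla_T T = 0. *)
Lemma geodesic_path y : geodesic nilmetric (orbit_path y).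
Proof.
split; first exact: orbit_path_continuous.
move=> _ [a _ <-] s /= ds.
have [v lv nv] := hsec_near ds.
have nx k : {near s, (fun r => hsec a (orbit_path y r) 0 k) =1
    (fun r => hmul nil_heis v y 0 k + r * e0 0 k)}.
  have : \forall r \near s, hsec a (hpi nil_heis (y + r *: e0)) =
    hmul nil_heis v (y + r *: e0).
    exact: (path_continuous nv).
  by apply: filterS => r e; rewrite /orbit_path e hmul_e0 !mxE.
have dx k : derive1 (fun r => hsec a (orbit_path y r) 0 k) s = e0 0 k.
  have /nbhs_singleton := near_derive1n 1 (nx k).
  by rewrite !derive1n1 derive1_affine.
split=> [k l|k].
  have [a' [b' e]] := derive1n_affine (hmul nil_heis v y 0 k) (e0 0 k) l.
  have nd := near_derive1n l (nx k).
  have nd' : {near s, (fun r : R => a' + r * b') =1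
      derive1n l (fun r => hsec a (orbit_path y r) 0 k)}.
    by apply: filterS nd => r ->; rewrite e.
  exact: near_eq_derivable nd' (@derivable_affine a' b' s).
have -> : derive1 (derive1 (fun r => hsec a (orbit_path y r) 0 k)) s = 0.
  have /nbhs_singleton := near_derive1n 2 (nx k); rewrite [LHS]/= => ->.
  by rewrite derive1nS derive1n1 derive1_affine derive1E derive_cst.
rewrite add0r (bigD1 i0)//= [X in _ + X]big1 ?addr0; last first.
  by move=> i /negbTE i00; apply: big1 => l _; rewrite dx mxE i00 mulr0 mul0r.
rewrite (bigD1 i0)//= [X in _ + X]big1 ?addr0; last first.
  by move=> i /negbTE i00; rewrite [X in _ * X]dx mxE i00 mulr0.
rewrite christoffel_0 [X in X * _ * _](_ : _ = 0) ?mul0r//.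
set z := hsec _ _; rewrite -[LHS](_ : (e0 *m covT z) 0 k = _);
  first by rewrite covT_00 mxE.
by rewrite -rowE mxE.
Qed.

Lemma closed_geodesic_path y : closed_geodesic nilmetric (orbit_path y).
Proof.
split; first exact: geodesic_path.
  exists (trigo.pi *+ 2) => [|s]; first by rewrite pmulrn_lgt0 ?pi_gt0.
  rewrite /orbit_path scalerDl addrA.
  by have := hpi_period (y + s *: e0) 1; rewrite mulr1.
(* At a time below 1 [hpi_inj] still separates the lift from its starting point. *)
exists (4^-1) => /hpi_inj e.
have : y + 4^-1 *: e0 = y + 0 *: e0.
  apply: e => i; rewrite !mxE mul0r addr0 opprD addrA subrr sub0r normrN normrM.
  case: (_ && _) => /=; first by rewrite normr1 mulr1 ger0_norm; lra.
  by rewrite normr0 mulr0.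
move=> {e} /rowP/(_ i0); rewrite !mxE !eqxx /= => ?; lra.
Qed.

Lemma cos_sin_inj (a b : R) : cos a = cos b -> sin a = sin b ->
  exists k : int, a = b + trigo.pi *+ 2 * k%:~R.
Proof.
move=> c s; have p0 : 0 < trigo.pi *+ 2 :> R by rewrite pmulrn_lgt0 ?pi_gt0.
pose k := Num.floor ((a - b) / (trigo.pi *+ 2)).
pose r := a - b - trigo.pi *+ 2 * k%:~R.
have /andP[k1 k2] := floor_itv ((a - b) / (trigo.pi *+ 2)).
have r0 : 0 <= r by rewrite /r subr_ge0 mulrC -ler_pdivlMr.
have r1 : r < trigo.pi *+ 2.
  move: k2; rewrite ltr_pdivrMr// -/k rmorphD /= mulrDl mul1r => k2.
  by rewrite /r; lra.
have cr : cos r = 1.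
  have -> : r = trigo.pi *+ 2 * (- k)%:~R + (a - b) by rewrite /r rmorphN /=; ring.
  have [-> _] := cos_sin_2pi (- k) (a - b).
  by rewrite cosB c s -!expr2 cos2Dsin2.
(* The half angle r / 2 lies in [0, pi), where the sine vanishes only at 0. *)
have sr : sin (r / 2) = 0.
  have : cos r = 1 - 2 * sin (r / 2) ^+ 2.
    have {1}-> : r = (r / 2) *+ 2 by rewrite mulr2n; lra.
    by rewrite cos_mulr2n cos2sin2 mulr2n; ring.
  by rewrite cr => e; apply/eqP; rewrite -sqrf_eq0; apply/eqP; lra.
have r00 : r = 0.
  apply/eqP; rewrite eq_le r0 andbT leNgt; apply/negP => rp.
  have : 0 < sin (r / 2) by apply: sin_gt0_pi; rewrite mulr2n in r1;
    apply/andP; split; lra.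
  by rewrite sr ltxx.
by exists k; move: r00; rewrite /r => ?; lra.
Qed.

Definition circle_fun (f : R -> R) (x : nilmfd) : R := f (hrep x 0 i0).

Lemma circle_funE f y :
  (forall (k : int) (r : R), f (trigo.pi *+ 2 * k%:~R + r) = f r) ->
  circle_fun f (hpi nil_heis y) = f (y 0 i0).
Proof.
move=> per; have /esym/hpiP[v lv e] := hrepK (hpi nil_heis y).
have [k vk] := lv i0; rewrite /circle_fun e /hmul !mxE vk /= /mper eqxx mulr0 addr0.
exact: per.
Qed.

Definition fibre_path (b : basemfd) (s : R) : nilmfd := hpi nil_heis (glue s
  (hrep b)).

Lemma fibre_pathE b s : fibre_path (hpi base_heis b) s = hpi nil_heis (glue s b).
Proof.
have /esym/hpiP[w lw e] := hrepK (hpi base_heis b).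
rewrite /fibre_path e; set v := glue (trigo.pi *+ 2 * 0%:~R) w.
have -> : glue s (hmul base_heis w b) = hmul nil_heis v (glue s b).
  rewrite -[RHS]glue_tail tail_hmul !tail_glue; congr glue.
  by rewrite /hmul !mxE /v !glue0 /= !mulr0 add0r addr0.
exact/hpi_mul/glue_lat.
Qed.

(** In a smooth family the circle parameter is the last coordinate, whereas t is the first one of
    the total space; this matrix performs the reordering. *)
Definition gluemx : 'M[R]_(NB + 1, N) :=
  \matrix_(k, i) (match fintype.split k with
                  | inl a => (i == shift_ix a)%:R | inr _ => (i == i0)%:R end).

Lemma gluemxE (y : 'rV[R]_(NB + 1)) : glue (rsubmx y 0 0) (lsubmx y) = y *m gluemx.
Proof.
apply/rowP => i; rewrite [RHS]mxE big_split_ord /= big_ord1.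
rewrite [in RHS]mxE (unsplitK (inr _)).
have [->|[a ->]] := index_case i.
  rewrite glue0 big1 ?add0r ?eqxx ?mulr1 => [|a _]; first by rewrite !mxE.
  by rewrite mxE (unsplitK (inl _)) mulr0.
rewrite glue_shift_ix shift_ix_neq0 mulr0 addr0 (bigD1 a)//= big1 ?addr0.
  by rewrite !mxE (unsplitK (inl _)) eqxx mulr1.
by move=> b ba; rewrite mxE (unsplitK (inl _)) (inj_eq shift_ix_inj) eq_sym
  (negbTE ba) mulr0.
Qed.

Lemma fibre_path_smooth : smooth_family_on setT fibre_path.
Proof.
split=> [b s _|_ _ [b _ <-] [a _ <-] k].
  pose x := hrep b.
  (* [fibre_path] uses a choice of representatives that need not be continuous; near b the local
     section [hsec x] replaces it, and [fibre_pathE] shows that the resulting point is the same. *)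
  pose f (q : basemfd * R) := glue q.2 (hsec x q.1).
  have xb : hdom x b by exists x; [exact: ballxx|exact: hrepK].
  have nf : \forall q \near (b, s), fibre_path q.1 q.2 = hpi nil_heis (f q).
    have : \forall q \near (b, s), hdom x q.1.
      apply: (@cvg_fst _ _ (nbhs b) (nbhs s) _ (hdom x)).
      by apply: open_nbhs_nbhs; split; [exact: hdom_open|].
    apply: filterS => q xq; rewrite /f -fibre_pathE; congr fibre_path.
    by rewrite hsec_pi.
  have cf : {for (b, s), continuous f}.
    apply: rV_continuous_at => i0' i; rewrite ord1.
    have [->|[c ->]] := index_case i.
      rewrite (_ : (fun q => _) = snd); first exact: cvg_snd.
      by apply/funext => q; rewrite /f glue0.
    rewrite (_ : (fun q => _) = (fun y : 'rV[R]_NB => y 0 c) \o hsec x \o fst).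
      apply: continuous_comp; first exact: cvg_fst.
      apply: continuous_comp; first exact: hsec_continuous.
      exact: coord_continuous.
    by apply/funext => q; rewrite /f glue_shift_ix.
  have ch : {for (b, s), continuous (hpi nil_heis \o f)}.
    by apply: continuous_comp => //; exact: hpi_continuous.
  change (fibre_path q.1 q.2 @[q --> (b, s)] --> fibre_path b s).
  rewrite (nbhs_singleton nf); apply: cvg_trans ch; apply: near_eq_cvg.
  by apply: filterS nf => q ->.
apply/smooth_onE => y /= [_ dy].
rewrite fibre_pathE gluemxE in dy.
have [v lv nv] := hsec_near dy.
apply: (@smooth_at_affine _ _ _ _ (gluemx *m hlin nil_heis v) v).
have : \forall z \near y, hsec a (hpi nil_heis (z *m gluemx)) =
  hmul nil_heis v (z *m gluemx).
  have c := @affine_continuous R _ _ gluemx 0 y.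
  have e : (fun z : 'rV[R]_(NB + 1) => z *m gluemx + 0) = (fun z => z *m gluemx).
    by apply/funext => z; rewrite addr0.
  by rewrite e in c; exact: (c _ nv).
by apply: filterS => z e; rewrite fibre_pathE gluemxE e hmulE mulmxA.
Qed.

Lemma base_proj_smooth : smooth_map_on (M := nilmfd) (B := basemfd) setT base_proj.
Proof.
split=> [x _|_ _ [a _ <-] [b _ <-] k]; first exact: base_proj_continuous.
apply/smooth_onE => _ [x [[ax _] bx] <-] /=.
have ea := hsec_pi ax.
have dx : hdom b (hpi base_heis (tail (hsec a x))).
  by rewrite -prE ea.
have [v lv nv] := hsec_near dx.
apply: (@smooth_at_affine _ _ _ _ (tailmx *m hlin base_heis v) v).
have : \forall z \near hsec a x, hsec b (hpi base_heis (tail z)) =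
  hmul base_heis v (tail z).
  exact: (tail_continuous nv).
by apply: filterS => z e; rewrite /local_rep /= prE e hmulE tailmxE mulmxA.
Qed.

Lemma circle_fun_smooth f : (forall (k : int) (r : R), f (trigo.pi *+ 2 * k%:~R
  + r) = f r) ->
  trigpoly (fun y : 'rV[R]_N => f (y 0 i0)) ->
  smooth_fun_on (M := nilmfd) (base_proj @^-1` setT) (circle_fun f).
Proof.
move=> per tf _ [a _ <-]; apply/smooth_onE => y _ /=.
apply: (@near_smooth_at _ _ (fun y : 'rV[R]_N => f (y 0 i0))).
  by apply: near_all => z; rewrite circle_funE.
exact: trigpoly_smooth.
Qed.

Lemma circle_fibration_base_proj : circle_fibration (M := nilmfd) (B :=
  basemfd) base_proj.
Proof.
split; first exact: base_proj_smooth.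
have pc (k : int) (x : R) := (cos_sin_2pi k x).1.
have ps (k : int) (x : R) := (cos_sin_2pi k x).2.
(* The total space is the product of a circle and the base, so a single global trivialization works
   at every b. *)
move=> b; exists setT, (circle_fun cos), (circle_fun sin), fibre_path.
split=> //; first exact: openT.
split.
- split; apply: circle_fun_smooth => //; [exact: tp_cos|exact: tp_sin].
- by move=> x _; rewrite /circle_fun cos2Dsin2.
- exact: fibre_path_smooth.
- by move=> b' s _; split; rewrite ?prE ?tail_glue ?hrepK ?circle_funE ?glue0.
- move=> x s _; rewrite -(hrepK x) prE !circle_funE// => c s'.
  have [k e] := cos_sin_inj c s'.
  rewrite fibre_pathE -(hpi_period _ k); congr hpi.
  apply/rowP => i; rewrite !mxE; have [->|[a ->]] := index_case i.
    by rewrite glue0 eqxx /= mulr1 e.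
  by rewrite glue_shift_ix shift_ix_neq0 mulr0 addr0 mxE.
Qed.

End Fibration.

(** * Derivatives along lines and under translation *)

Section LineDerivatives.
Context {R : realType} {n : nat}.
Implicit Types (f : 'rV[R]_n -> R) (v y : 'rV[R]_n).

Lemma derivable_line f v y (s : R) : derivable f (y + s *: v) v ->
  is_derive s 1 (fun r => f (y + r *: v)) ('D_v f (y + s *: v)).
Proof.
have e : (fun h : R => h^-1 *: (((fun r => f (y + r *: v)) \o shift s) (h *: 1) -
    f (y + s *: v))) =
    (fun h => h^-1 *: ((f \o shift (y + s *: v)) (h *: v) - f (y + s *: v))).
  apply/funext => h; congr (_ *: (f _ - _)); rewrite /shift /= scalerDl.
  by rewrite -[h *: 1]/(h * 1) mulr1 addrCA.
by move=> df; apply: DeriveDef; [rewrite /derivable e|rewrite /derive e].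
Qed.

Lemma partial_shift f i v y : partial i (fun z => f (z + v)) y =
  partial i f (y + v).
Proof.
have e : (fun h : R => h^-1 *: (((fun z => f (z + v)) \o shift y) (h *: 'e_i) -
    f (y + v))) =
    (fun h => h^-1 *: ((f \o shift (y + v)) (h *: 'e_i) - f (y + v))).
  by apply/funext => h; congr (_ *: (f _ - _)); rewrite /shift /= addrA.
by rewrite /partial /derive e.
Qed.

Lemma constant_on_line f v y (t : R) : 0 <= t ->
  (forall s, 0 <= s <= t -> derivable f (y + s *: v) v /\ 'D_v f (y + s *: v) =
    0) ->
  f (y + t *: v) = f y.
Proof.
move=> t0 df; pose g (r : R) := f (y + r *: v).
have dg s : 0 <= s <= t -> is_derive s 1 g 0.
  by move=> /df[d <-]; exact: derivable_line.
have [||c _] := @MVT_segment R g (fun=> 0) 0 t t0.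
- by move=> s; rewrite in_itv /= => /andP[/ltW s0 /ltW st]; apply: dg; rewrite s0.
- by apply: derivable_within_continuous => s; rewrite in_itv /= => /dg[].
rewrite mul0r => /eqP; rewrite subr_eq0 /g scale0r addr0 => /eqP.
by [].
Qed.

End LineDerivatives.

(** * The metric is not bundle-like *)

Section NotBundleLike.
Context {R : realType} (j : nat).
Local Notation m := (j + j)%N.
Local Notation N := (4 + m)%N.
Local Notation J := (@symJ R j).
Local Notation i0 := (i0 j).
Local Notation i1 := (i1 j).
Local Notation i2 := (i2 j).
Local Notation e0 := (delta_mx 0 i0 : 'rV[R]_N).
Local Notation nil_heis := (@nil_heis R j).
Local Notation gram := (@gram R j).
Local Notation nilmfd := (@nilmfd R j).
Local Notation nilmetric := (@nilmetric R j).
Local Notation nilfol := (@nilfol R j).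
Local Notation Phi := (@Phi R j).

Lemma Phi_path (t : R) : Phi (t *: e0) = cof0 j *m rot j t.
Proof.
rewrite /Phi -lock hlin_def -scaleNr -scalemxAl e0_J scaler0 trmx0 mul0mx addr0.
by rewrite mul1mx !mxE !eqxx mulr1.
Qed.

(** On the leaf through 0 this vector has z = 1 and w = 1, so z - Re (e^(-it) w) = 1 - cos t and its
    transverse length varies with t. *)
Let u : 'rV[R]_N := 'e_i1 + 'e_i2.

Lemma frame_path (t : R) : u *m Phi (t *: e0) =
  row_mx (\row_a nth 0 [:: 1; 1 - cos t; cos t; - sin t] a) 0.
Proof.
rewrite Phi_path mulmxA /u mulmxDl /cof0 -lock !e_bd add_row_mx addr0.
rewrite /rot /rot_gen -!lock bdM /bd scale_block_mx scale_block_mx scalar_mx_block.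
rewrite !add_block_mx mul_row_block mulmx0 !mul0mx !addr0; congr row_mx;
  last by rewrite !scaler0 !addr0 mulmx0.
rewrite mx4M; apply/rowP => a.
rewrite mxE !big_ord_recl big_ord0 !mxE.
by move: a => -[[|[|[|[|//]]]] ?] /=; rewrite ?mulr1n ?mulr0n; ring.
Qed.

Definition hpart (y w : 'rV[R]_N) : 'rV[R]_N := w - ip (gram y) w e0 *: e0.

Lemma hpart_orth y w a : ip (gram y) (hpart y w) (a *: e0) = 0.
Proof. by rewrite ipZr /hpart -scaleNr ipDl ipZl gram_00 mulr1 subrr mulr0. Qed.

(* For a bundle-like metric this would not depend on t. *)
Lemma hpart_path (t : R) :
  ip (gram (t *: e0)) (hpart (t *: e0) u) (hpart (t *: e0) u) =
    1 + (1 - cos t) ^+ 2.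
Proof.
have e : ip (gram (t *: e0)) u e0 = 1.
  rewrite ip_congr e0_Phi frame_path /ip -mulmxA -[gram0 j]gram0_tr -trmx_mul
    e0_gram0.
  rewrite trmx_delta -colE mxE (_ : i0 = lshift m (@Ordinal 4 0 isT))// row_mxEl.
  by rewrite mxE.
rewrite /hpart e scale1r ip_congr mulmxBl e0_Phi frame_path gram0_diag diag_form.
rewrite big_split_ord /= [X in _ + X]big1 => [|a _]; last first.
  by rewrite !mxE (unsplitK (inr _)) !mxE eq_rlshift /= subr0 expr0n /= mulr0.
rewrite !big_ord_recl big_ord0 !mxE !(unsplitK (inl _)) !mxE !eq_lshift /dcoef /=.
rewrite !subr0 subrr sqrrN sin2cos2; ring.
Qed.

Section Submersion.
Variables (q : nat) (Q : manifold R q) (h : metric Q) (W : set nilmfd) (f :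
  nilmfd -> Q).
Hypothesis (fW : riemannian_submersion_on nilmetric h W f).
Hypothesis (fF : forall x c d, W x -> atlas c -> atlas d -> cdom c x ->
  cdom d (f x) ->
  forall v, tangent nilfol c (cmap c x) v <->
            v *m jac (local_rep c d f) (cmap c x) = 0).

(** Since f is constant along leaves, it is locally invariant under small shifts in t, so its
    Jacobians at 0 and at t e0 agree. A Riemannian submersion would give u the same transverse
    length at both points, against [hpart_path]. *)
Lemma not_submersion : open W -> W (hpi nil_heis 0) -> False.
Proof.
move=> oW W0; have [[cf sf] rf] := fW.
have [d ad d0] := atlas_cover (f (hpi nil_heis 0)).
pose c := hchart nil_heis 0; have ac : atlas (m := nilmfd) c by exists 0.
pose phi := local_rep c d f.
have [eps e0' sub] : exists2 eps, 0 < eps & forall y, ball 0 eps y ->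
    [/\ ball 0 2^-1 y, W (hpi nil_heis y) & cdom d (f (hpi nil_heis y))].
  have n1 : nbhs (0 : 'rV[R]_N) (ball 0 2^-1).
    by apply: open_nbhs_nbhs; split; [exact: ball_open|exact: ballxx].
  have n2 : nbhs (hpi nil_heis 0) W by exact: open_nbhs_nbhs.
  have n3 : nbhs (f (hpi nil_heis 0)) (cdom d).
    by apply: open_nbhs_nbhs; split; [exact: cdom_open|].
  have n4 := cf _ W0 _ n3.
  have n5 : nbhs (0 : 'rV[R]_N) (hpi nil_heis @^-1` (W `&` f @^-1` cdom d)).
    exact: (hpi_continuous (filterI n2 n4)).
  have /nbhs_ballP[eps /= e0' sub] : nbhs (0 : 'rV[R]_N)
      (ball 0 2^-1 `&` hpi nil_heis @^-1` (W `&` f @^-1` cdom d)) by exact: filterI.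
  exists eps => // y ye.
  by have [? []] := sub y ye.
have dom y : ball 0 eps y -> [/\ W (hpi nil_heis y), cdom c (hpi nil_heis y),
    cdom d (f (hpi nil_heis y)) & cmap c (hpi nil_heis y) = y].
  by move=> /sub[hy wy dy]; split=> //=; [exists y|rewrite hsecK].
have e0J y : ball 0 eps y -> e0 *m jac phi y = 0.
  move=> /dom[wy cy dy ey]; have [+ _] := fF wy ac ad cy dy e0.
  rewrite ey; apply; apply/(tangentP _ ac); first by rewrite -ey;
    exists (hpi nil_heis y).
  by rewrite mxE !eqxx scale1r.
have dphi k y : ball 0 eps y -> derivable (fun z => phi z 0 k) y e0.
  move=> ye; have [wy cy dy ey] := dom _ ye.
  have := sf c d ac ad k [::] y; case; last by move=> _; exact.
  by exists (hpi nil_heis y) => //; split=> //; split.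
have Dphi k y : ball 0 eps y -> 'D_e0 (fun z => phi z 0 k) y = 0.
  move=> /e0J /rowP/(_ k); rewrite -rowE [LHS]mxE [LHS]mxE [RHS]mxE.
  by [].
(* Segments of length t from the ball of radius eps / 2 stay in the ball of radius eps, and t < 2 <=
   pi keeps cos t below 1. *)
pose t := Num.min (eps / 2) 1 / 2.
have [t0 t1 t2] : [/\ 0 < t, t < eps / 2 & t < 2].
  have a1 : 0 < Num.min (eps / 2) 1 by rewrite lt_min divr_gt0/=.
  have a2 : Num.min (eps / 2) 1 <= eps / 2 by rewrite ge_min lexx.
  have a3 : Num.min (eps / 2) 1 <= 1 by rewrite ge_min lexx orbT.
  by rewrite /t; split; lra.
have bline y s : ball 0 (eps / 2) y -> 0 <= s <= t -> ball 0 eps (y + s *: e0).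
  have h2 : 0 < eps / 2 by rewrite divr_gt0.
  move=> /(ball_rVE _ _ h2) yb /andP[s0 st]; apply/ball_rVE => // i.
  have := yb i; rewrite !mxE !sub0r !normrN => yi.
  apply: le_lt_trans (ler_normD _ _) _; rewrite normrM (ger0_norm s0).
  have : `|(0 == 0 :> 'I_1) && (i == i0)|%:R <= 1 :> R.
    by case: (_ && _).
  have -> : `|((0 == 0 :> 'I_1) && (i == i0))%:R| =
    ((0 == 0 :> 'I_1) && (i == i0))%:R :> R.
    by rewrite ger0_norm.
  move=> _; have : s * ((0 == 0 :> 'I_1) && (i == i0))%:R <= s.
    by case: (_ && _); rewrite ?mulr1 ?mulr0.
  lra.
have phi_t y : ball 0 (eps / 2) y -> phi (y + t *: e0) = phi y.
  move=> yb; apply/rowP => k.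
  apply: (@constant_on_line _ _ (fun z => phi z 0 k) e0 y t); first exact: ltW.
  by move=> s st; have b := bline _ _ yb st; split; [exact: dphi|exact: Dphi].
have n0 : \forall y \near (0 : 'rV[R]_N), ball 0 (eps / 2) y.
  by apply: open_nbhs_nbhs; split; [exact: ball_open|apply: ballxx;
    rewrite divr_gt0].
have b0 := nbhs_singleton n0.
(* Invariance under the shift holds on a whole ball, so it can be differentiated in every
   direction. *)
have Jt : jac phi (t *: e0) = jac phi 0.
  apply/matrixP => i k; rewrite !mxE -[t *: e0]add0r -partial_shift.
  have np : {near (0 : 'rV[R]_N), (fun z => phi (z + t *: e0) 0 k) =1 (fun z =>
    phi z 0 k)}.
    by apply: filterS n0 => z /phi_t ->.
  exact: (nbhs_singleton (near_partial i np)).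
(* A vector and its horizontal part have the same image because e0 is in the kernel of the
   Jacobian. *)
have qE y : ball 0 eps y -> ip (gram y) (hpart y u) (hpart y u) =
    ip (gm h d (phi y)) (u *m jac phi y) (u *m jac phi y).
  move=> ye; have [wy cy dy ey] := dom _ ye.
  have [_] := rf _ _ _ wy ac ad cy dy; rewrite ey => /(_ (hpart y u) (hpart y u)).
  have -> : hpart y u *m jac phi y = u *m jac phi y.
    by rewrite /hpart mulmxBl -scalemxAl e0J// scaler0 subr0.
  move=> <-; first by rewrite /phi /local_rep /=.
    move=> w wJ; have [_ tw] := fF wy ac ad cy dy w; rewrite ey in tw.
    have cy' : cimg c y by rewrite -ey; exists (hpi nil_heis y).
    by rewrite (iffLR (tangentP w ac cy') (tw wJ)); exact: hpart_orth.
  move=> w wJ; have [_ tw] := fF wy ac ad cy dy w; rewrite ey in tw.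
  have cy' : cimg c y by rewrite -ey; exists (hpi nil_heis y).
  by rewrite (iffLR (tangentP w ac cy') (tw wJ)); exact: hpart_orth.
have tt : 0 <= t <= t by rewrite lexx ltW.
have bt : ball 0 eps (t *: e0) by rewrite -[t *: e0]add0r; exact: bline.
have b0' : ball (0 : 'rV[R]_N) eps 0 by exact: ballxx.
have phit : phi (t *: e0) = phi 0 by rewrite -[t *: e0]add0r; exact: phi_t.
have := qE _ bt; rewrite phit Jt -(qE _ b0') hpart_path.
have := hpart_path 0; rewrite scale0r => ->; rewrite cos0 subrr expr0n /= addr0.
move=> /eqP; rewrite -subr_eq0 addrAC subrr add0r sqrf_eq0 subr_eq0 => /eqP c1.
have p2 := pi_ge2 R.
have : cos t < cos (0 : R).
  by rewrite ltr_cos ?in_itv /= ?lexx ?(ltW t0) ?pi_ge0//=; lra.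
by rewrite cos0 -c1 ltxx.
Qed.

End Submersion.

Lemma not_bundle_like : ~ bundle_like nilmetric nilfol.
Proof.
move=> /(_ (hpi nil_heis 0))[W [oW W0 [Q [h [f [fW fF]]]]]].
exact: (not_submersion fW fF oW W0).
Qed.

End NotBundleLike.

(** * Spectrum and parallelism of R_T *)

Section Spectrum.
Context {R : realType} (j : nat).
Local Notation m := (j + j)%N.
Local Notation N := (4 + m)%N.
Local Notation i0 := (i0 j).
Local Notation i2 := (i2 j).
Local Notation e0 := (delta_mx 0 i0 : 'rV[R]_N).
Local Notation nil_heis := (@nil_heis R j).
Local Notation gram := (@gram R j).
Local Notation nilmfd := (@nilmfd R j).
Local Notation nilmetric := (@nilmetric R j).
Local Notation nilfol := (@nilfol R j).
Local Notation Phi := (@Phi R j).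
Local Notation Psi := (@Psi R j).

Definition indmx n (P : pred 'I_n) : 'M[R]_n := diag_mx (\row_a (P a)%:R).

Lemma rank_indmx_le n (P : pred 'I_n) : (\rank (indmx P) <= #|P|)%N.
Proof.
have -> : indmx P = \sum_(a | P a) delta_mx a a.
  apply/matrixP => a b; rewrite summxE !mxE.
  have [->|ab] := eqVneq a b; last first.
    rewrite mulr0n big1// => c _; rewrite mxE.
    by case: (a =P c) => //= <-; rewrite eq_sym (negbTE ab).
  rewrite mulr1n; case: (boolP (P b)) => Pb.
    rewrite (bigD1 b)//= mxE !eqxx big1 ?addr0// => c /andP[_ /negbTE cb].
    by rewrite mxE eq_sym cb.
  rewrite big1// => c Pc; rewrite mxE; case: eqP => // bc.
  by rewrite -bc (negbTE Pb) in Pc.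
rewrite -sum1_card; elim/big_ind2: _ => [|A x B y Ax By|a _].
- by rewrite mxrank0.
- exact: leq_trans (mxrank_add _ _) (leq_add Ax By).
- by rewrite mxrank_delta.
Qed.

(** The upper bounds for P and for its complement add up to n, the rank of the identity, so both are
    attained. *)
Lemma rank_indmx n (P : pred 'I_n) : \rank (indmx P) = #|P|.
Proof.
apply/eqP; rewrite eqn_leq rank_indmx_le /=.
have e : indmx P + indmx (predC P) = 1%:M.
  apply/matrixP => a b; rewrite !mxE /=.
  by case: (a == b); case: (P a); rewrite /= ?mulr1n ?mulr0n ?addr0 ?add0r.
have := mxrank_add (indmx P) (indmx (predC P)); rewrite e mxrank1 => le1.
rewrite -(leq_add2r #|predC P|) (cardC P) card_ord; apply: leq_trans le1 _.
by rewrite leq_add2l rank_indmx_le.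
Qed.

Lemma lin1_RT c (T : 'rV[R]_N -> 'rV[R]_N) (y : 'rV[R]_N) : c * c = 1 ->
  {near y, T =1 fun=> c *: e0} -> RT_mx gram T y = jacobi_op y.
Proof.
move=> cc nT; apply/matrixP => a b; rewrite mxE.
have dc : derivable_mx i0 (fun _ : 'rV[R]_N => 'e_a : 'rV[R]_N) y.
  by move=> k l; exact: derivable_cst.
rewrite (RT_near nT dc).
by rewrite cc scale1r -rowE mxE.
Qed.

Definition eigpred (a : R) : pred 'I_N := [pred b | (b != i0) && (kcoef b == a)].

Lemma eigpredE a b : eigpred a b = (b != i0) && (kcoef b == a).
Proof. by []. Qed.

(** In the moving frame R_T is diagonal and orthogonality to T is the vanishing of the entry at
    [i0], so the eigenspace is spanned by frame vectors. *)
Lemma RT_eigenspaceE c (T : 'rV[R]_N -> 'rV[R]_N) (y : 'rV[R]_N) a : c * c = 1 ->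
  {near y, T =1 fun=> c *: e0} ->
  (RT_eigenspace gram T y a :=: indmx (eigpred a) *m Psi y)%MS.
Proof.
move=> cc nT; rewrite /RT_eigenspace (lin1_RT cc nT) (nbhs_singleton nT).
have c0 : c != 0 by apply: contra_eq_neq cc => ->; rewrite mul0r eq_sym oner_eq0.
have kerE (v : 'rV[R]_N) : (v <= kermx (gram y *m (c *: e0)^T))%MS =
  ((v *m Phi y) 0 i0 == 0).
  have -> : (v <= kermx (gram y *m (c *: e0)^T))%MS = (c * (v *m Phi y) 0 i0 == 0).
    have e : v *m (gram y *m (c *: e0)^T) = (c * (v *m Phi y) 0 i0)%:M.
      rewrite [LHS]mx11_scalar; congr (_%:M).
      rewrite linearZ /= -!scalemxAr mxE; congr (_ * _).
      rewrite mulmxA -[LHS]/(ip (gram y) v e0) ip_congr e0_Phi /ip -mulmxA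
        -[gram0 j]gram0_tr.
      by rewrite -trmx_mul e0_gram0 trmx_delta -colE mxE.
    apply/idP/idP => [/sub_kermxP|/eqP h]; last first.
      by apply/sub_kermxP; rewrite e h; apply/matrixP => ? ?; rewrite !mxE mul0rn.
    by rewrite e => /matrixP/(_ 0 0); rewrite [LHS]mxE [RHS]mxE eqxx mulr1n => ->.
  by rewrite mulf_eq0 (negbTE c0).
have eigE (v : 'rV[R]_N) : (v <= eigenspace (jacobi_op y) a)%MS <->
    (v *m Phi y) *m jacobi0 j = a *: (v *m Phi y).
  rewrite jacobi_opE /frame; split=> [/eigenspaceP e|e].
    rewrite scalemxAl -e !mulmxA -(mulmxA _ (Psi y)) PsiPhi mulmx1.
    by [].
  apply/eigenspaceP; rewrite !mulmxA e -scalemxAl -mulmxA PhiPsi mulmx1.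
  by [].
have indE (w : 'rV[R]_N) b : (w *m indmx (eigpred a)) 0 b =
  w 0 b * (eigpred a b)%:R.
  by rewrite /indmx mul_mx_diag !mxE.
apply/eqmxP/andP; split; apply/rV_subP => v.
  rewrite sub_capmx kerE => /andP[/eigE/jacobi0_eigen h /eqP h0].
  apply/submxP; exists (v *m Phi y).
  rewrite mulmxA -[LHS]mulmx1 -(PhiPsi y) mulmxA; congr (_ *m _).
  apply/rowP => b; rewrite indE eigpredE.
  have [->|_] := eqVneq b i0; first by rewrite h0 mul0r.
  by have [->|->] := h b; rewrite ?mul0r// eqxx mulr1.
move=> /submxP[x ->]; rewrite sub_capmx kerE.
have e : x *m (indmx (eigpred a) *m Psi y) *m Phi y = x *m indmx (eigpred a).
  by rewrite mulmxA -mulmxA PsiPhi mulmx1.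
rewrite e indE eigpredE eqxx mulr0 eqxx andbT; apply/eigE; rewrite e.
apply/jacobi0_eigen => b; rewrite indE eigpredE.
have [->|bi] := eqVneq b i0; first by left; rewrite mulr0.
by case: eqP => [->|_]; [right|left; rewrite mulr0].
Qed.

Lemma rank_RT_eigenspace c (T : 'rV[R]_N ->
  'rV[R]_N) (y : 'rV[R]_N) a : c * c = 1 ->
  {near y, T =1 fun=> c *: e0} -> \rank (RT_eigenspace gram T y a) = #|eigpred a|.
Proof.
move=> cc nT; rewrite (RT_eigenspaceE a cc nT) mxrankMfree ?rank_indmx//.
by rewrite row_free_unit; have [] := mulmx1_unit (PsiPhi y).
Qed.

Lemma card_eigpred1 : #|eigpred 1| = 1%N.
Proof.
apply: etrans (card1 i2); apply: eq_card => b; rewrite !inE /kcoef.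
have q : (4^-1 == 1 :> R) = false by apply/negbTE/eqP => ?; lra.
rewrite -!val_eqE /=; case: (val b) => [|[|[|k]]] //=; rewrite ?q ?eqxx//.
Qed.

Lemma card_eigpred4 : #|eigpred (4^-1)| = (N - 2)%N.
Proof.
have q : (1 == 4^-1 :> R) = false by apply/negbTE/eqP => ?; lra.
have q0 : (0 == 4^-1 :> R) = false by apply/negbTE/eqP => ?; lra.
have e : #|eigpred (4^-1)| = #|predC (pred2 i0 i2)|.
  apply: eq_card => b; rewrite !inE /kcoef -!val_eqE /=.
  by case: (nat_of_ord b) => [|[|[|k]]] //=; rewrite ?q ?eqxx.
rewrite e; apply: (canRL (addKn 2)).
by have := cardC (pred2 i0 i2); rewrite card2 card_ord.
Qed.

Lemma spectrum_RT c (T : 'rV[R]_N -> 'rV[R]_N) (y : 'rV[R]_N) : c * c = 1 ->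
  {near y, T =1 fun=> c *: e0} ->
  RT_spectrum gram T y = [set 4^-1; 4 * 4^-1].
Proof.
move=> cc nT; have q : 4 * 4^-1 = 1 :> R by rewrite mulfV// pnatr_eq0.
rewrite q; apply/seteqP; split=> a; rewrite /RT_spectrum /= -mxrank_eq0
  (rank_RT_eigenspace a cc nT).
  rewrite -lt0n => /card_gt0P[b]; rewrite inE /= /kcoef => /andP[b0].
  rewrite -val_eqE /= in b0; rewrite (negbTE b0).
  by case: ifP => _ /eqP <-; [right|left].
by case=> ->; rewrite ?card_eigpred1 ?card_eigpred4//.
Qed.

(** The coefficient of e0 takes the values 1 and -1; by continuity it moves by less than 1 near y,
    so its sign is locally constant. *)
Lemma unit_tangent_near (c : chart R N nilmfd) (V : set 'rV[R]_N) T y :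
  atlas c -> open V -> V `<=` cimg c ->
    unit_tangent_field nilmetric nilfol c V T -> V y ->
  exists2 s : R, s * s = 1 & {near y, T =1 fun=> s *: e0}.
Proof.
move=> ac oV Vc [sT uT] Vy.
have TE z : V z -> T z = T z 0 i0 *: e0 /\ T z 0 i0 * T z 0 i0 = 1.
  move=> Vz; have [/(tangentP _ ac (Vc _ Vz)) e] := uT z Vz.
  by rewrite e ipZl ipZr gram_00 mulr1 -e.
exists (T y 0 i0); first by have [] := TE y Vy.
have cT : {for y, continuous (fun z => T z 0 i0)}.
  by have [+ _] := sT i0 [::] y Vy.
have n1 : \forall z \near y, `|T y 0 i0 - T z 0 i0| < 1.
  exact: (cT _ (nbhsx_ballx (T y 0 i0) 1 ltr01)).
have nV : \near y, V y by exact: open_nbhs_nbhs.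
apply: filterS (filterI n1 nV) => z [zy Vz].
have [eTz ez] := TE z Vz; rewrite eTz; congr (_ *: _); move=> {eTz}.
have [_ ey] := TE y Vy; move: zy ez ey.
move: (T z 0 i0) (T y 0 i0) => a b ab aa bb.
have : (a - b) * (a + b) = 0 by rewrite mulrDr !mulrBl aa bb; ring.
move=> /eqP; rewrite mulf_eq0 subr_eq0 => /orP[/eqP//|].
rewrite addr_eq0 => /eqP e; rewrite e opprK in ab.
move: ab; rewrite -mulr2n ltr_norml => /andP[a1 a2].
by nra.
Qed.

Lemma derivable_mxD p q k (F E : 'rV[R]_N -> 'M[R]_(p, q)) y :
  derivable_mx k F y -> derivable_mx k E y -> derivable_mx k (fun z => F z + E z) y.
Proof. by move=> dF dE a b; under eq_fun do rewrite mxE; exact: derivableD. Qed.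

Lemma derivable_mxB p q k (F E : 'rV[R]_N -> 'M[R]_(p, q)) y :
  derivable_mx k F y -> derivable_mx k E y -> derivable_mx k (fun z => F z - E z) y.
Proof.
move=> dF dE a b; under eq_fun do rewrite mxE [X in _ + X]mxE.
exact: derivableB.
Qed.

Lemma near_derivable_mx p q k (F E : 'rV[R]_N -> 'M[R]_(p, q)) (y : 'rV[R]_N) :
  {near y, F =1 E} -> derivable_mx k F y -> derivable_mx k E y.
Proof.
move=> FE dF a b; apply: near_eq_derivable (dF a b).
by apply: filterS FE => z ->.
Qed.

(** [jacobi0_comm] trades the commutator with L for the one with nabla T, which then cancels against
    the connection terms of nabla_T. *)
Lemma pmx_jacobi_op y : pmx i0 (@jacobi_op R j) y =
  covT y *m jacobi_op y - jacobi_op y *m covT y.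
Proof.
rewrite covTE jacobi_opE pmx_frame !frameM frameN frameD; congr (frame _ y).
have := @jacobi0_comm R j; rewrite mulmxBl mulmxBr => /eqP;
  rewrite subr_eq => /eqP ->.
by apply/matrixP => a b; rewrite !mxE; ring.
Qed.

Lemma jacobi_op_ip0 (v : 'rV[R]_N) y : ip (gram y) (v *m jacobi_op y) e0 = 0.
Proof.
have e : v *m jacobi_op y *m Phi y = v *m Phi y *m jacobi0 j.
  by rewrite jacobi_opE /frame -!mulmxA PsiPhi mulmx1.
rewrite ip_congr e0_Phi e /ip -[gram0 j]gram0_tr -mulmxA -trmx_mul e0_gram0.
by rewrite -mulmxA jacobi0_e0 mulmx0 mxE.
Qed.

(** Both terms equal (nabla_T U) R_T up to the same sign. The projections onto T^perp change
    nothing, since R_T kills T and has its image orthogonal to T. *)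
Lemma RT_parallel (c : chart R N nilmfd) (V : set 'rV[R]_N) T :
  atlas c -> open V -> V `<=` cimg c -> unit_tangent_field nilmetric nilfol c V T ->
  RT_parallel_on gram V T.
Proof.
move=> ac oV Vc uT U sU _ y Vy.
have [s ss nT] := unit_tangent_near ac oV Vc uT Vy.
have Ty := nbhs_singleton nT.
have nV : \near y, V y by exact: open_nbhs_nbhs.
have dU z : V z -> derivable_mx i0 U z.
  by move=> Vz a b; rewrite ord1; have [_] := sU b [::] z Vz; exact.
have dU2 : derivable_mx i0 (pmx i0 U) y.
  move=> a b; rewrite ord1; have [_ /(_ i0)] := sU b [:: i0] y Vy.
  by under [in X in _ -> X]eq_fun do rewrite mxE.
have dC : derivable_mx i0 (@covT R j) y.
  by rewrite covTE; exact/trigpoly_derivable_mx/trigpoly_frame.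
have dK : derivable_mx i0 (@jacobi_op R j) y.
  by rewrite jacobi_opE; exact/trigpoly_derivable_mx/trigpoly_frame.
have dG : derivable_mx i0 gram y by exact/trigpoly_derivable_mx/trigpoly_gram.
have dcst p q (A : 'M[R]_(p, q)) : derivable_mx i0 (fun=> A) y.
  by move=> a b; exact: derivable_cst.
have nablaT Y z : {near z, T =1 fun=> s *: e0} ->
    nabla gram T Y z = s *: (pmx i0 Y z + Y z *m covT z).
  move=> nTz; rewrite -nabla_e0; apply: near_nabla;
    first exact: (nbhs_singleton nTz).
  exact: near_all.
have nnT := near_join nT.
have nRT : {near y, RT gram T U =1 fun z => U z *m jacobi_op z}.
  near=> z; have nTz : {near z, T =1 fun=> s *: e0} by near: z.
  have dUz : derivable_mx i0 U z by apply: dU; near: z.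
  by rewrite (RT_near nTz dUz) ss scale1r.
have dUy := dU y Vy.
have [dUK eUK] := derivable_mxM dUy dK.
have X1 : nabla gram T (RT gram T U) y =
  s *: ((pmx i0 U y + U y *m covT y) *m jacobi_op y).
  rewrite nablaT// (near_pmx i0 nRT) (nbhs_singleton nRT) eUK pmx_jacobi_op.
  congr (_ *: _); rewrite mulmxDl mulmxBr !mulmxA.
  by rewrite addrA subrK.
pose X z := pmx i0 U z + U z *m covT z.
(* [RT_near] asks for t-derivability of the field to which it is applied; this expression of
   [nabla_perp] as a matrix product, with the inner product as a 1 x 1 matrix, provides it. *)
pose Y z : 'rV[R]_N := s *: (X z - X z *m gram z *m e0^T *m e0).
have nY : {near y, Y =1 nabla_perp gram T U}.
  near=> z; have nTz : {near z, T =1 fun=> s *: e0} by near: z.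
  rewrite /nabla_perp nablaT// (nbhs_singleton nTz) /Y scalerBr; congr (_ - _).
  have -> : X z *m gram z *m e0^T = (ip (gram z) (X z) e0)%:M by exact: mx11_scalar.
  rewrite ipZl ipZr mul_scalar_mx !scalerA; congr (_ *: _); rewrite -/(X z).
  have -> : s * (s * ip (gram z) (X z) e0) * s =
    s * s * (s * ip (gram z) (X z) e0) by ring.
  by rewrite ss mul1r.
have dX : derivable_mx i0 X y.
  exact: derivable_mxD dU2 (derivable_mxM dUy dC).1.
have dY : derivable_mx i0 Y y.
  have [d1 _] := derivable_mxM dX dG.
  have [d2 _] := derivable_mxM d1 (dcst _ _ e0^T).
  have [d3 _] := derivable_mxM d2 (dcst _ _ e0).
  have d4 := derivable_mxB dX d3.
  have [d5 _] := derivable_mxM (dcst _ _ (s%:M : 'M[R]_1)) d4.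
  have -> : Y = (fun z => s%:M *m (X z - X z *m gram z *m e0^T *m e0)).
    by apply/funext => z; rewrite mul_scalar_mx.
  exact: d5.
have dN := near_derivable_mx nY dY.
rewrite (@RT_near _ _ s T (nabla_perp gram T U))// ss scale1r -(nbhs_singleton nY).
rewrite /nabla_perp X1 Ty -/(X y) ipZl ipZr jacobi_op_ip0 !mulr0 scale0r subr0.
rewrite /Y -scalemxAl mulmxBl -(mulmxA _ e0) (_ : e0 *m jacobi_op y =
  0) ?mulmx0 ?subr0 ?subrr//.
by rewrite jacobi_opE /frame !mulmxA e0_Phi e0_jacobi0 mul0mx.
Unshelve. all: by end_near. Qed.

End Spectrum.

Theorem theorem1p2 (R : realType) (N : nat) (hN : (4 <= N)%N)
    (hNeven : ~~ odd N) :
  exists (M : manifold R N) (g : metric M) (F : foliation M 1)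
         (B : manifold R N.-1) (p : M -> B),
    [/\ closed_manifold M,
        totally_geodesic g F,
        Kmix_positive g F,
        (forall x : M, exists2 gam : R -> M,
           closed_geodesic g gam & leaf F x = range gam)
      & [/\ circle_fibration p,
            (forall x : M, leaf F x = p @^-1` [set p x]) /\ range p = setT,
            ~ bundle_like g F
          & exists2 kappa : R, 0 < kappa &
            forall (c : chart R N M), atlas c ->
            forall V : set 'rV[R]_N, open V -> V `<=` cimg c ->
            forall T : 'rV[R]_N -> 'rV[R]_N, unit_tangent_field g F c V T ->
              RT_parallel_on (gm g c) V T /\
              forall y, V y ->
                [/\ RT_spectrum (gm g c) T y = [set kappa; 4 * kappa],
                    \rank (RT_eigenspace (gm g c) T y (4 * kappa)) = 1%N
                  & \rank (RT_eigenspace (gm g c) T y kappa) = (N - 2)%N]]].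
Proof.
have [j ->] : exists j, N = (4 + (j + j))%N.
  exists (N - 4)./2; rewrite addnn halfK oddB// (negbTE hNeven) /= subn0.
  by rewrite subnKC.
exists (nilmfd j), (nilmetric j), (nilfol j), (basemfd j), (@base_proj R j); split.
- exact: hmfd_closed.
- exact: totally_geodesic_nilfol.
- exact: Kmix_positive_nilfol.
- move=> x; exists (orbit_path (hrep x)); first exact: closed_geodesic_path.
  exact: leaf_range.
split.
- exact: circle_fibration_base_proj.
- by split=> [x|]; [exact: leaf_fibre|exact: base_proj_surj].
- exact: not_bundle_like.
exists 4^-1 => // c ac V oV Vc T uT; split; first exact: RT_parallel ac oV Vc uT.
move=> y Vy; have [s ss nT] := unit_tangent_near ac oV Vc uT Vy.
have q : 4 * 4^-1 = 1 :> R by rewrite mulfV// pnatr_eq0.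
split; first exact: spectrum_RT ss nT.
- by rewrite q; apply: etrans (rank_RT_eigenspace _ ss nT) (card_eigpred1 j).
- exact: etrans (rank_RT_eigenspace _ ss nT) (card_eigpred4 j).
Qed.
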